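(* Let $W$ be an infinitely divisible real-valued random variable with $\mathbb{E}[W]=\mathbb{E}[W^3]=0$, $\mathbb{E}[W^2]=1$, and with finite fourth moment. Let $h:\mathbb{R}\to\mathbb{R}$ be twice differentiable with absolutely continuous first derivative. Then $$|\mathbb{E}h(W)-\mathbb{E}h(Z)|\leq\frac{1}{3}\lVert h''\rVert\left(\mathbb{E}[W^4]-3\right),$$ where $Z\sim\mathrm{N}(0,1)$.
   Context: $\lVert g\rVert=\sup_{x\in\mathbb{R}}|g(x)|$. A random variable $W$ is infinitely divisible if for each $n=1,2,\ldots$ it is equal in distribution to a sum of $n$ independent and identically distributed random variables. *)

(* Defs.v *)
From HB Require Import structures.
From mathcomp Require Import all_boot all_order all_algebra.
From mathcomp Require Import all_classical all_reals all_analysis.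

Set Implicit Arguments.
Unset Strict Implicit.
Unset Printing Implicit Defensive.
Import Order.TTheory GRing.Theory Num.Theory.
Import numFieldNormedType.Exports.

Local Open Scope classical_set_scope.
Local Open Scope ring_scope.

Section defs.
Variable R : realType.

(* Possibly +oo. *)
Definition supnorm (g : R -> R) : \bar R :=
  ereal_sup (range (fun x => `|g x|%:E)).

(* Absolute continuity of a function on the whole line, that is, on every
   compact interval. *)
Definition absolutely_continuous (f : R -> R) : Prop :=
  forall a b e : R, 0 < e -> exists2 delta : R, 0 < delta &
    forall (n : nat) (u v : 'I_n -> R),
      (forall i, a <= u i /\ u i <= v i /\ v i <= b) ->
      trivIset setT (fun i => [set` `]u i, v i[]) ->
      \sum_(i < n) (v i - u i) < delta ->
      \sum_(i < n) `|f (v i) - f (u i)| < e.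

(* Laws are compared on measurable sets only: measures are total functions on
   sets, with unspecified values at non-measurable ones. *)
Definition same_law (mu nu : set (measurableTypeR R) -> \bar R) : Prop :=
  forall A, measurable A -> mu A = nu A.

Definition mutually_independent (d : measure_display) (T : measurableType d)
    (P : probability T R) (n : nat) (X : 'I_n -> {RV P >-> R}) : Prop :=
  forall (J : {set 'I_n}) (A : 'I_n -> set (measurableTypeR R)),
    (forall i, measurable (A i)) ->
    P (\bigcap_(i in [set` J]) (X i @^-1` A i)) =
    (\prod_(i in J) P (X i @^-1` A i))%E.

Definition iid (d : measure_display) (T : measurableType d)
    (P : probability T R) (n : nat) (X : 'I_n -> {RV P >-> R}) : Prop :=
  mutually_independent X /\
  forall i j, same_law (distribution P (X i)) (distribution P (X j)).

(* The summands may live on another probability space than W. *)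
Definition infinitely_divisible (d : measure_display) (T : measurableType d)
    (P : probability T R) (W : {RV P >-> R}) : Prop :=
  forall n : nat, (0 < n)%N ->
    exists (d' : measure_display) (T' : measurableType d')
           (Q : probability T' R) (X : 'I_n -> {RV Q >-> R}),
      iid X /\
      same_law (distribution P W)
               (pushforward Q (fun w => \sum_(i < n) X i w)).

End defs.

(* Main.v *)
Require Import Defs.
From HB Require Import structures.
From mathcomp Require Import all_boot all_order all_algebra.
From mathcomp Require Import all_classical all_reals all_analysis.
From mathcomp Require Import measurable_realfun.
From mathcomp Require Import ring lra.

Set Implicit Arguments.
Unset Strict Implicit.
Unset Printing Implicit Defensive.
Import Order.TTheory GRing.Theory Num.Theory.
Import numFieldNormedType.Exports.

Local Open Scope classical_set_scope.
Local Open Scope ring_scope.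

(** Why the bound holds. Write w x = exp (- x^2 / 2), c = E h(Z),
M for the supremum of |h''|, and kappa = E W^4 - 3 for the fourth cumulant
of W. If f solves the Stein equation f' x - x * f x = h x - c, then
E h(W) - E h(Z) = E f'(W) - E (W f(W)). The bound M * kappa / 3 combines
two estimates.

Analysis: the solution f = w^-1 * (primitive of (h - c) * w) satisfies
|f'''| <= 2 * M ([stein_solution]). Differentiating the Stein equation twice
gives, for g = f', the linear equation g'' - x g' - 2 g = h''. This operator
obeys a comparison principle that is stronger than the maximum principle
([second_order_comparison]): if g'' - x g' - 2 g <= 0 and g, g' grow
polynomially, then x g' + 2 g >= 0. Applied to M / 2 + g and M / 2 - g it gives
|x g' + 2 g| <= M, hence |f'''| = |g''| <= 2 * M. The comparison principle
comes from the iterated tails t_0 x = \int_x^oo w, t_1 = \int_x^oo t_0 and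
t_2 = 2 \int_x^oo t_1 of the Gaussian weight: g' t_1 + g t_2 has derivative
t_1 (g'' - x g' - 2 g) and tends to 0 at infinity.

Probability: if |f'''| <= K, then |E (W f(W)) - E f'(W)| <= K * kappa / 6
([infinitely_divisible_stein_bound]). Write W as a sum of n independent and
identically distributed X_i. Cumulants are additive, so each X_i has mean 0,
variance 1 / n, third moment 0, and n * E X_i^4 = kappa + 3 / n
([iid_decomposition]). With S_i = W - X_i, which is independent of X_i, a Taylor
expansion of f at S_i leaves E (X_i f(W)) = E X_i^2 * E f'(S_i) up to
K * E X_i^4 / 6, because E X_i = E X_i^3 = 0; replacing S_i by W in E f'(S_i)
costs O(1 / n). Summing over i and letting n tend to infinity gives the bound,
and kappa >= 0 because n * E X_i^4 >= 0 ([fourth_cumulant_ge0]).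

When h'' is unbounded the right-hand side is infinite unless kappa = 0, in which
case it is 0. Then the bound for test functions with a bounded second derivative
forces W to be normal ([same_law_of_smooth]), and both expectations agree. *)

(** * Real functions: derivatives, limits, primitives over half-lines *)

Section real_analysis.
Context {R : realType}.
Local Notation lambda := (@lebesgue_measure R).
Implicit Types (f g D k : R -> R) (a x y : R).

Lemma is_derive_continuous f f' :
  (forall x : R, is_derive x 1 f (f' x)) -> continuous f.
Proof.
by move=> df x; apply/differentiable_continuous/derivable1_diffP; case: (df x).
Qed.

Lemma MVT_le f f' x y : x <= y -> (forall z : R, is_derive z 1 f (f' z)) ->
  exists2 z, x <= z <= y & f y - f x = f' z * (y - x).
Proof.
move=> xy df; have [|z] := MVT_segment xy (fun z _ => df z).
  exact/continuous_subspaceT/is_derive_continuous.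
by rewrite in_itv/= => zxy ->; exists z.
Qed.

(** This is how every inequality between tails is proved below: a
function that decreases to 0 at infinity is nonnegative, so that an integral
estimate reduces to a pointwise estimate of derivatives. *)
Lemma ge0_of_nincr_cvg0 D D' a : (forall x : R, is_derive x 1 D (D' x)) ->
  (forall x, a <= x -> D' x <= 0) -> D x @[x --> +oo] --> (0 : R) ->
  forall x, a <= x -> 0 <= D x.
Proof.
move=> dD D'0 Dcvg x ax; apply: (cvgr_to_le Dcvg).
near=> y; have xy : x <= y by near: y; apply: nbhs_pinfty_ge; rewrite num_real.
have [z /andP[xz _] Dyx] := MVT_le xy dD.
rewrite -subr_le0 Dyx; apply: mulr_le0_ge0; last by rewrite subr_ge0.
by apply: D'0; rewrite (le_trans ax).
Unshelve. all: by end_near. Qed.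

(** Along any sequence tending to infinity, the integrands restricted to
the half-lines converge pointwise, being eventually constant at each point. *)
Lemma cvg_integral_itvNyy k :
  lambda.-integrable setT (EFin \o k) ->
  (\int[lambda]_(t in `]-oo, x]) k t)%R @[x --> +oo]
    --> (\int[lambda]_t k t)%R.
Proof.
move=> ik; apply/cvg_pinftyP => u uy.
have [mk _] := integrableP _ _ _ ik.
pose kn n : R -> \bar R := (EFin \o k) \_ `]-oo, u n].
have [] := @dominated_convergence _ _ _ lambda setT measurableT kn
  (EFin \o k) (fun t => `|(k t)%:E|)%E.
- move=> n; apply: (@measurable_int _ _ _ lambda).
  apply: (proj1 (@integrable_mkcond _ _ _ lambda `]-oo, u n] (EFin \o k) _)).
    exact: measurable_itv.
  exact: (integrableS measurableT _ _ ik).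
- exact: mk.
- apply: aeW => t _; apply: cvg_near_cst; near=> n; rewrite /kn patchE ifT//.
  rewrite inE/= in_itv/=; near: n; move/cvgryPge: uy; exact.
- exact: integrable_abse.
- by apply: aeW => t n _; rewrite /kn patchE; case: ifP; rewrite ?abse0.
move=> _ _; rewrite /Rintegral => kncvg.
apply: fine_cvg; rewrite fineK; last exact: integrable_fin_num.
apply: cvg_trans kncvg; apply: near_eq_cvg; near=> n.
by rewrite [in RHS]integral_mkcond.
Unshelve. all: by end_near. Qed.

Lemma cvg_integral_itvNyNy k :
  lambda.-integrable setT (EFin \o k) ->
  (\int[lambda]_(t in `]-oo, x]) k t)%R @[x --> -oo] --> (0 : R).
Proof.
move=> ik; apply/cvg_ninftyP => u uy.
have [mk _] := integrableP _ _ _ ik.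
pose kn n : R -> \bar R := (EFin \o k) \_ `]-oo, u n].
have [] := @dominated_convergence _ _ _ lambda setT measurableT kn
  (cst 0%E) (fun t => `|(k t)%:E|)%E.
- move=> n; apply: (@measurable_int _ _ _ lambda).
  apply: (proj1 (@integrable_mkcond _ _ _ lambda `]-oo, u n] (EFin \o k) _)).
    exact: measurable_itv.
  exact: (integrableS measurableT _ _ ik).
- exact: measurable_cst.
- apply: aeW => t _; apply: cvg_near_cst; near=> n; rewrite /kn patchE ifF//.
  apply/negbTE; rewrite notin_setE/= in_itv/=; apply/negP.
  rewrite -ltNge; near: n; move/cvgrNyPlt: uy; exact.
- exact: integrable_abse.
- by apply: aeW => t n _; rewrite /kn patchE; case: ifP; rewrite ?abse0.
move=> _ _; rewrite integral0 /Rintegral => kncvg.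
apply: fine_cvg; apply: cvg_trans kncvg; apply: near_eq_cvg; near=> n.
by rewrite [in RHS]integral_mkcond.
Unshelve. all: by end_near. Qed.

Lemma is_derive_integral_itvNy k : continuous k ->
  lambda.-integrable setT (EFin \o k) ->
  forall x : R, is_derive x 1 (fun y => \int[lambda]_(t in `]-oo, y]) k t)%R (k x).
Proof.
move=> ck ik x.
have xx1 : x < x + 1 by rewrite ltrDl.
have ikx := @integrableS _ _ _ lambda _ `]-oo, x + 1] _ measurableT
  (measurable_itv _) (@subsetT _ _) ik.
have [dF F'] := continuous_FTC1 xx1 ikx (ltNyr x) (ck x).
by apply: (DeriveDef dF); rewrite -F' derive1E.
Qed.

End real_analysis.

(** * The Gaussian weight *)

Section gaussian_weight.
Context {R : realType}.
Local Notation lambda := (@lebesgue_measure R).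
Implicit Types (u D k : R -> R) (a b x y : R).

Definition gauss_weight x : R := expR (- (x ^+ 2 / 2)).
Local Notation w := gauss_weight.

Lemma gauss_weight_gt0 x : 0 < w x.
Proof. exact: expR_gt0. Qed.

Lemma gauss_weightN x : w (- x) = w x.
Proof. by rewrite /w sqrrN. Qed.

Lemma is_derive_gauss_weight x : is_derive x 1 w (- x * w x).
Proof.
have -> : w = expR \o (fun y => - (y ^+ 2 / 2)) by [].
have d2 : is_derive x 1 (fun y : R => - (y ^+ 2 / 2)) (- x).
  apply: is_derive_eq; rewrite /GRing.scale/=; lra.
by apply: is_derive_eq; rewrite /GRing.scale/= mulrC.
Qed.

Lemma is_derive_comp_opp u u' : (forall x : R, is_derive x 1 u (u' x)) ->
  forall x : R, is_derive x 1 (fun y => u (- y)) (- u' (- x)).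
Proof.
move=> du x; have := @is_derive1_comp R u -%R x (u' (- x)) (-1).
by rewrite mulrN1; apply.
Qed.

(** One term of the exponential series already dominates [x ^+ n.+1]. *)
Lemma exprM_gauss_weight_le n x : 1 <= x ->
  x ^+ n * w x <= (n.+1`!%:R * 2 ^+ n.+1) / x.
Proof.
move=> x1; have x0 : 0 < x by lra.
have /= := @expR_ge1Dxn R (x ^+ 2 / 2) n; rewrite divr_ge0 ?sqr_ge0// => /(_ isT).
set c : R := _`!%:R; have c0 : 0 < c by rewrite ltr0n fact_gt0.
have w0 := expR_gt0 (x ^+ 2 / 2).
rewrite /w expRN => le_e.
rewrite ler_pdivlMr// mulrAC -exprSr ler_pdivrMr//.
have : x ^+ n.+1 <= (x ^+ 2) ^+ n.+1.
  by apply: lerXn2r; rewrite ?nnegrE ?sqr_ge0//; nra.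
have : (x ^+ 2 / 2) ^+ n.+1 / c <= expR (x ^+ 2 / 2) by apply: le_trans le_e; rewrite lerDr.
rewrite ler_pdivrMr// expr_div_n ler_pdivrMr ?exprn_gt0// => h1 h2.
apply: (le_trans h2); apply: (le_trans h1).
suff -> : expR (x ^+ 2 / 2) * c * 2 ^+ n.+1 = c * 2 ^+ n.+1 * expR (x ^+ 2 / 2) by [].
by ring.
Qed.

Lemma cvg0_le_gauss_weight u C n :
  (forall x, 1 <= x -> `|u x| <= C * (x ^+ n * w x)) ->
  u x @[x --> +oo] --> (0 : R).
Proof.
move=> uw; set K : R := `|C| * (n.+1`!%:R * 2 ^+ n.+1).
have uK x : 1 <= x -> `|u x| <= K / x.
  move=> x1; apply: (le_trans (uw x x1)).
  apply: (@le_trans _ _ (`|C| * (x ^+ n * w x))).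
    apply: ler_wpM2r (ler_norm _).
    by rewrite mulr_ge0// ?exprn_ge0 ?ltW ?gauss_weight_gt0//; lra.
  by rewrite /K -mulrA ler_wpM2l// exprM_gauss_weight_le.
apply/cvgr0Pnorm_le => e e0; near=> x.
have x1 : 1 <= x by near: x; apply: nbhs_pinfty_ge; rewrite num_real.
apply: (le_trans (uK x x1)).
rewrite ler_pdivrMr; last lra.
by rewrite mulrC -ler_pdivrMr.
Unshelve. all: by end_near. Qed.


Lemma integrable_normal_fun s : s != 0 ->
  lambda.-integrable setT (EFin \o normal_fun 0 s).
Proof.
move=> s0; have p0 := normal_peak_gt0 s0.
have := integrableZl measurableT (normal_peak s)^-1 (integrable_normal_pdf 0 s).
apply: eq_integrable => // x _.
by rewrite normal_pdfE//= -EFinM mulrA mulVf ?mul1r// gt_eqF.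
Qed.

Lemma integrable_gauss_weight : lambda.-integrable setT (EFin \o w).
Proof.
have := integrable_normal_fun (oner_neq0 R).
apply: eq_integrable => // x _; rewrite /= /normal_fun /w.
by congr (expR _)%:E; rewrite subr0 expr1n mulNr.
Qed.

(** Half of the exponent absorbs the factor [x ^+ 2]; what remains is the
unnormalized density with variance 2, which is integrable. *)
Lemma sqr_mul_expR_le x : x ^+ 2 * w x <= 4 * normal_fun 0 (Num.sqrt 2) x.
Proof.
have -> : normal_fun 0 (Num.sqrt 2) x = expR (- (x ^+ 2 / 4)).
  by rewrite /normal_fun subr0 sqr_sqrtr//; congr expR; field.
have -> : w x = expR (- (x ^+ 2 / 4)) * expR (- (x ^+ 2 / 4)).
  by rewrite -expRD /w; congr expR; field.
set y := x ^+ 2 / 4; have -> : x ^+ 2 = 4 * y by rewrite /y; field.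
have y0 := expR_gt0 (- y).
have : y * expR (- y) <= 1.
  by rewrite expRN ler_pdivrMr ?expR_gt0// mul1r; have := expR_ge1Dx y; lra.
nra.
Qed.

Lemma integrable_mul_gauss_weight k a b : continuous k ->
  (forall x, `|k x| <= a + b * x ^+ 2) ->
  lambda.-integrable setT (EFin \o (fun x => k x * w x)).
Proof.
move=> ck kab.
have b0 : 0 <= `|b| by [].
have s2 : Num.sqrt 2 != 0 :> R by rewrite gt_eqF// sqrtr_gt0.
apply: (@le_integrable _ _ _ lambda _ measurableT _
  (EFin \o (fun x => `|a| * w x + `|b| * (4 * normal_fun 0 (Num.sqrt 2) x)))).
- apply/measurable_EFinP; apply: measurable_funM.
    exact: continuous_measurable_fun.
  apply: continuous_measurable_fun.
  exact: (is_derive_continuous is_derive_gauss_weight).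
- move=> x _; rewrite /= lee_fin normrM (ger0_norm (ltW (gauss_weight_gt0 x))).
  have w0 := gauss_weight_gt0 x.
  rewrite [leRHS]ger0_norm; last first.
    by rewrite addr_ge0// !mulr_ge0// ?normal_fun_ge0// ltW.
  have h1 : `|k x| * w x <= (`|a| + `|b| * x ^+ 2) * w x.
    apply: (ler_wpM2r (ltW w0)); apply: le_trans (kab x) _.
    by rewrite lerD ?ler_norm//; apply: (ler_wpM2r (sqr_ge0 x)); apply: ler_norm.
  apply: (le_trans h1); rewrite mulrDl lerD2l -mulrA ler_wpM2l//.
  exact: sqr_mul_expR_le.
- have i1 := integrable_gauss_weight; have i2 := integrable_normal_fun s2.
  have := @integrableD _ _ _ lambda setT measurableT _ _
    (integrableZl measurableT `|a| i1)
    (integrableZl measurableT `|b| (integrableZl measurableT 4 i2)).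
  by apply: eq_integrable.
Qed.

End gaussian_weight.

(** * Iterated tails of the Gaussian weight *)

Section gaussian_tails.
Context {R : realType}.
Local Notation lambda := (@lebesgue_measure R).
Local Notation w := (@gauss_weight R).
Implicit Types (u D k F : R -> R) (a b x y : R).

(** The iterated tails of the weight: integrating by parts,
[gauss_tail1 x] and [gauss_tail2 x] are the integrals over t > x of
(t - x) * w t and (t - x)^2 * w t. The closed forms give their derivatives and
their decay directly. *)
Definition gauss_tail x : R :=
  (\int[lambda]_t w t - \int[lambda]_(t in `]-oo, x]) w t)%R.
Definition gauss_tail1 x : R := w x - x * gauss_tail x.
Definition gauss_tail2 x : R := (1 + x ^+ 2) * gauss_tail x - x * w x.
Local Notation t0 := gauss_tail.
Local Notation t1 := gauss_tail1.
Local Notation t2 := gauss_tail2.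

Let dw := @is_derive_gauss_weight R.

Lemma is_derive_gauss_tail x : is_derive x 1 t0 (- w x).
Proof.
have cw := is_derive_continuous dw.
have := is_derive_integral_itvNy cw (@integrable_gauss_weight R) x => dF.
have := @is_deriveB _ _ _ (cst (\int[lambda]_t w t)%R) _ x 1 _ _
  (is_derive_cst _ _ _) dF.
by rewrite sub0r.
Qed.

Lemma is_derive_gauss_tail1 x : is_derive x 1 t1 (- t0 x).
Proof.
have d0 := is_derive_gauss_tail x; have d := dw x.
rewrite /t1; apply: is_derive_eq; rewrite /GRing.scale/=; ring.
Qed.

Lemma is_derive_gauss_tail2 x : is_derive x 1 t2 (- (2 * t1 x)).
Proof.
have d0 := is_derive_gauss_tail x; have d := dw x.
rewrite /t2; apply: is_derive_eq; rewrite /GRing.scale/= /t1; ring.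
Qed.

Lemma gt0_of_decr_cvg0 D D' : (forall x : R, is_derive x 1 D (D' x)) ->
  (forall x, D' x < 0) -> D x @[x --> +oo] --> (0 : R) -> forall x, 0 < D x.
Proof.
move=> dD D'0 D0 x.
have D1 : 0 <= D (x + 1).
  by apply: (ge0_of_nincr_cvg0 dD) D0 _ (lexx _) => y _; exact: ltW.
have [|z _] := @MVT_le _ D D' x (x + 1) _ dD; first lra.
have := D'0 z; have -> : x + 1 - x = 1 by ring.
lra.
Qed.

Lemma cvg_gauss_tail : t0 x @[x --> +oo] --> (0 : R).
Proof.
have := cvg_integral_itvNyy (@integrable_gauss_weight R).
by move=> /(cvgB (cvg_cst (\int[lambda]_t w t)%R)); rewrite subrr.
Qed.

Lemma gauss_tail_gt0 x : 0 < t0 x.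
Proof.
apply: (gt0_of_decr_cvg0 is_derive_gauss_tail _ cvg_gauss_tail) => y.
by rewrite oppr_lt0 gauss_weight_gt0.
Qed.

Lemma gauss_tail_le x : 1 <= x -> t0 x <= w x.
Proof.
move=> x1; rewrite -subr_ge0.
pose D' y := - y * w y + w y.
have dD (y : R) : is_derive y 1 (fun z => w z - t0 z) (D' y).
  have d0 := is_derive_gauss_tail y; have d := dw y.
  by apply: is_derive_eq; rewrite /D' opprK.
apply: (ge0_of_nincr_cvg0 dD _ _ x1).
  by move=> y y1; rewrite /D'; have := gauss_weight_gt0 y; nra.
have cw : w y @[y --> +oo] --> (0 : R).
  apply: (@cvg0_le_gauss_weight R w 1 0) => y _.
  by rewrite expr0 !mul1r ger0_norm// ltW// gauss_weight_gt0.
have := cvgB cw cvg_gauss_tail; rewrite subr0; exact.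
Qed.

Lemma gauss_tail1_le x : 1 <= x -> `|t1 x| <= 2 * (x ^+ 1 * w x).
Proof.
move=> x1; have t0w := gauss_tail_le x1; have t00 := gauss_tail_gt0 x.
have w0 := gauss_weight_gt0 x; rewrite /t1 expr1 ler_norml; apply/andP; split; nra.
Qed.

Lemma gauss_tail2_le x : 1 <= x -> `|t2 x| <= 3 * (x ^+ 2 * w x).
Proof.
move=> x1; have t0w := gauss_tail_le x1; have t00 := gauss_tail_gt0 x.
have w0 := gauss_weight_gt0 x.
have q0 : 0 <= 1 + x ^+ 2 by have := sqr_ge0 x; lra.
have h1 := mulr_ge0 q0 (ltW t00).
have h2 := ler_wpM2l q0 t0w.
have h3 : x * w x <= x ^+ 2 * w x by rewrite ler_pM2r// expr2; nra.
have h4 : 0 <= x * w x by apply: mulr_ge0; [lra|exact: ltW].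
have h5 : w x <= x * w x by nra.
by rewrite /t2 ler_norml; apply/andP; split; lra.
Qed.

Lemma gauss_tail1_gt0 x : 0 < t1 x.
Proof.
apply: (gt0_of_decr_cvg0 is_derive_gauss_tail1).
  by move=> y; rewrite oppr_lt0 gauss_tail_gt0.
exact: cvg0_le_gauss_weight gauss_tail1_le.
Qed.

Lemma gauss_tail2_gt0 x : 0 < t2 x.
Proof.
apply: (gt0_of_decr_cvg0 is_derive_gauss_tail2).
  by move=> y; rewrite oppr_lt0 mulr_gt0 ?gauss_tail1_gt0.
exact: cvg0_le_gauss_weight gauss_tail2_le.
Qed.

(** This is the next iterated tail, the integral of (t - x)^3 * w t: its
derivative is - 3 times the previous one. *)
Lemma gauss_tail3_gt0 x : 0 < 2 * t1 x - x * t2 x.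
Proof.
apply: (@gt0_of_decr_cvg0 (fun x => 2 * t1 x - x * t2 x) (fun x => - (3 * t2 x))).
- move=> y; have d1 := is_derive_gauss_tail1 y; have d2 := is_derive_gauss_tail2 y.
  apply: is_derive_eq; rewrite /GRing.scale/= /t2 /t1; ring.
- by move=> y; rewrite oppr_lt0 mulr_gt0 ?gauss_tail2_gt0.
- apply: (@cvg0_le_gauss_weight _ _ 7 3) => y y1.
  have := gauss_tail1_le y1; have := gauss_tail2_le y1.
  have w0 := gauss_weight_gt0 y.
  rewrite expr1 => h2 h1; apply: (le_trans (ler_normB _ _)).
  rewrite !normrM (ger0_norm (_ : 0 <= 2)) // (ger0_norm (_ : 0 <= y)); last lra.
  have h3 : y * `|t2 y| <= y * (3 * (y ^+ 2 * w y)) by rewrite ler_wpM2l//; lra.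
  have h4 : y * w y <= y ^+ 3 * w y.
    by rewrite ler_pM2r// -[leLHS]expr1 ler_weXn2l.
  have -> : 7 * (y ^+ 3 * w y) = 2 * (2 * (y ^+ 3 * w y)) + y * (3 * (y ^+ 2 * w y)).
    by ring.
  lra.
Qed.

End gaussian_tails.

(** * Polynomial growth and Taylor bounds *)

Section polynomial_growth.
Context {R : realType}.
Implicit Types (u v : R -> R) (a b x y : R) (m n : nat).

(** Growth of any degree is absorbed by the Gaussian weight; growth of degree at
most 4 is integrable under the law of a variable with a fourth moment. *)
Definition poly_growth n u := exists C, forall x, `|u x| <= C * (1 + `|x|) ^+ n.

Lemma poly_growth_cst a : poly_growth 0 (cst a).
Proof. by exists `|a| => x; rewrite expr0 mulr1. Qed.

Lemma poly_growth_id : poly_growth 1 (id : R -> R).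
Proof. by exists 1 => x; rewrite expr1 mul1r lerDr. Qed.

Lemma poly_growth_le m n u : (m <= n)%N -> poly_growth m u -> poly_growth n u.
Proof.
move=> mn [C uC]; exists `|C| => x; apply: (le_trans (uC x)).
have x1 : 1 <= 1 + `|x| by rewrite lerDl.
apply: (@le_trans _ _ (`|C| * (1 + `|x|) ^+ m)).
  by apply: (ler_wpM2r _ (ler_norm C)); rewrite exprn_ge0//; lra.
by rewrite ler_wpM2l// ler_weXn2l.
Qed.

Lemma poly_growthD n u v : poly_growth n u -> poly_growth n v ->
  poly_growth n (fun x => u x + v x).
Proof.
move=> [C uC] [D vD]; exists (C + D) => x; rewrite mulrDl.
exact: le_trans (ler_normD _ _) (lerD (uC x) (vD x)).
Qed.

Lemma poly_growthM m n u v : poly_growth m u -> poly_growth n v ->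
  poly_growth (m + n) (fun x => u x * v x).
Proof.
move=> [C uC] [D vD]; exists (C * D) => x.
by rewrite normrM exprD mulrACA ler_pM.
Qed.

Lemma poly_growthN n u : poly_growth n u -> poly_growth n (fun x => - u x).
Proof. by move=> [C uC]; exists C => x; rewrite normrN. Qed.

Lemma poly_growth_oppr n u : poly_growth n u -> poly_growth n (fun x => u (- x)).
Proof. by move=> [C uC]; exists C => x; rewrite -(normrN x). Qed.

Lemma poly_growth_bounded u C : (forall x, `|u x| <= C) -> poly_growth 0 u.
Proof. by move=> uC; exists C => x; rewrite expr0 mulr1. Qed.

End polynomial_growth.

Section taylor.
Context {R : realType}.
Implicit Types (u v p q : R -> R) (K x t : R).

(** The mean value theorem applied to [q + p] and to [q - p]. Iterating this
lemma gives Taylor bounds from a pointwise bound on the last derivative. *)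
Lemma derive_le_le p q p' q' : (forall x : R, is_derive x 1 p (p' x)) ->
  (forall x : R, is_derive x 1 q (q' x)) -> p 0 = 0 -> q 0 = 0 ->
  (forall t, 0 <= t -> `|p' t| <= q' t) -> forall t, 0 <= t -> `|p t| <= q t.
Proof.
move=> dp dq p0 q0 pq t t_ge0; rewrite ler_norml; apply/andP; split.
  have d x : is_derive x (1 : R) (fun y => p y + q y) (p' x + q' x) by apply: is_derive_eq.
  have [z /andP[z0 _]] := MVT_le t_ge0 d.
  have : - q' z <= p' z by have := pq z z0; rewrite ler_norml => /andP[].
  rewrite p0 q0; nra.
have d x : is_derive x (1 : R) (fun y => q y - p y) (q' x - p' x) by apply: is_derive_eq.
have [z /andP[z0 _]] := MVT_le t_ge0 d.
have : p' z <= q' z by have := pq z z0; rewrite ler_norml => /andP[].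
rewrite p0 q0; nra.
Qed.

Lemma is_derive_shiftx u u' x : (forall y : R, is_derive y 1 u (u' y)) ->
  forall t : R, is_derive t 1 (fun s => u (x + s)) (u' (x + t)).
Proof.
move=> du t.
have dx : is_derive t 1 (fun s : R => x + s) 1.
  by have := is_deriveD (is_derive_cst x t 1) (is_derive_id t 1); rewrite add0r.
have := @is_derive1_comp R u _ t (u' (x + t)) 1 (du (x + t)) dx.
by rewrite mulr1.
Qed.

Lemma taylor1_ge0 u u1 K x t : (forall y : R, is_derive y 1 u (u1 y)) ->
  (forall y, `|u1 y| <= K) -> 0 <= t -> `|u (x + t) - u x| <= K * t.
Proof.
move=> du uK.
apply: (@derive_le_le (fun t => u (x + t) - u x) (fun t => K * t)
  (fun t => u1 (x + t)) (fun=> K)).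
- move=> y; have d := is_derive_shiftx x du y.
  by apply: is_derive_eq; rewrite subr0.
- by move=> y; apply: is_derive_eq; rewrite /GRing.scale/=; ring.
- by rewrite addr0 subrr.
- by rewrite mulr0.
- by [].
Qed.

Lemma taylor2_ge0 u u1 u2 K x t : (forall y : R, is_derive y 1 u (u1 y)) ->
  (forall y : R, is_derive y 1 u1 (u2 y)) ->
  (forall y, `|u2 y| <= K) -> 0 <= t ->
  `|u (x + t) - u x - t * u1 x| <= K * t ^+ 2 / 2.
Proof.
move=> du du1 uK.
apply: (@derive_le_le (fun t => u (x + t) - u x - t * u1 x)
  (fun t => K * t ^+ 2 / 2) (fun t => u1 (x + t) - u1 x) (fun t => K * t)).
- move=> y; have d := is_derive_shiftx x du y.
  by apply: is_derive_eq; rewrite /GRing.scale/=; ring.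
- by move=> y; apply: is_derive_eq; rewrite /GRing.scale/=; field.
- by rewrite addr0; ring.
- by ring.
- by move=> s s0; exact: taylor1_ge0 du1 uK s0.
Qed.

Lemma taylor3_ge0 u u1 u2 u3 K x t : (forall y : R, is_derive y 1 u (u1 y)) ->
  (forall y : R, is_derive y 1 u1 (u2 y)) ->
  (forall y : R, is_derive y 1 u2 (u3 y)) ->
  (forall y, `|u3 y| <= K) -> 0 <= t ->
  `|u (x + t) - u x - t * u1 x - t ^+ 2 / 2 * u2 x| <= K * t ^+ 3 / 6.
Proof.
move=> du du1 du2 uK.
apply: (@derive_le_le (fun t => u (x + t) - u x - t * u1 x - t ^+ 2 / 2 * u2 x)
  (fun t => K * t ^+ 3 / 6) (fun t => u1 (x + t) - u1 x - t * u2 x)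
  (fun t => K * t ^+ 2 / 2)).
- move=> y; have d := is_derive_shiftx x du y.
  by apply: is_derive_eq; rewrite /GRing.scale/=; field.
- by move=> y; apply: is_derive_eq; rewrite /GRing.scale/=; field.
- by rewrite addr0; ring.
- by ring.
- by move=> s s0; exact: taylor2_ge0 du1 du2 uK s0.
Qed.

(** For negative increments, reflect [u]. *)
Lemma taylor2 u u1 u2 K x t : (forall y : R, is_derive y 1 u (u1 y)) ->
  (forall y : R, is_derive y 1 u1 (u2 y)) -> (forall y, `|u2 y| <= K) ->
  `|u (x + t) - u x - t * u1 x| <= K * t ^+ 2 / 2.
Proof.
move=> du du1 uK; have [t0|/ltW t0] := leP 0 t.
  exact: taylor2_ge0 uK t0.
have d := is_derive_comp_opp du; have d1 y : is_derive y (1 : R) _ _ :=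
  is_deriveN (is_derive_comp_opp du1 y).
have := @taylor2_ge0 _ _ _ K (- x) (- t) d d1.
rewrite !opprK !opprD !opprK sqrrN mulrNN; apply; last by rewrite oppr_ge0.
by move=> y; rewrite opprK.
Qed.

Lemma taylor3 u u1 u2 u3 K x t : (forall y : R, is_derive y 1 u (u1 y)) ->
  (forall y : R, is_derive y 1 u1 (u2 y)) ->
  (forall y : R, is_derive y 1 u2 (u3 y)) -> (forall y, `|u3 y| <= K) ->
  `|u (x + t) - u x - t * u1 x - t ^+ 2 / 2 * u2 x| <= K * `|t| ^+ 3 / 6.
Proof.
move=> du du1 du2 uK; have [t0|/ltW t0] := leP 0 t.
  by rewrite (ger0_norm t0); exact: taylor3_ge0 uK t0.
have d := is_derive_comp_opp du; have d1 y : is_derive y (1 : R) _ _ :=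
  is_deriveN (is_derive_comp_opp du1 y).
have d2 y : is_derive y (1 : R) (fun y => u2 (- y)) (- u3 (- y)) :=
  is_derive_comp_opp du2 y.
have := @taylor3_ge0 _ _ (fun y => u2 (- y)) (fun y => - u3 (- y)) K (- x) (- t) d _ d2.
rewrite (ler0_norm t0) opprD !opprK sqrrN mulrNN; apply; last by rewrite oppr_ge0.
  by move=> y; have := d1 y; rewrite opprK.
by move=> y; rewrite normrN.
Qed.

Lemma poly_growth_primitive n u u1 : (forall y : R, is_derive y 1 u (u1 y)) ->
  poly_growth n u1 -> poly_growth n.+1 u.
Proof.
move=> du [C u1C]; exists (`|u 0| + `|C|) => x.
have [z zx ux] : exists2 z, `|z| <= `|x| & u x - u 0 = u1 z * x.
  have [x0|/ltW x0] := leP 0 x.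
    have [z /andP[z0 zx] ux] := MVT_le x0 du; exists z; last by rewrite ux subr0.
    by rewrite !ger0_norm.
  have [z /andP[xz z0] ux] := MVT_le x0 du; exists z; last first.
    by rewrite -[LHS]opprB ux sub0r mulrN opprK.
  by rewrite !ler0_norm// lerN2.
have x1 : 1 <= 1 + `|x| by rewrite lerDl.
rewrite -(subrKC (u 0) (u x)) ux mulrDl; apply: (le_trans (ler_normD _ _)).
apply: lerD; first by rewrite ler_peMr// exprn_ege1.
rewrite normrM exprSr mulrA; apply: ler_pM => //; last by rewrite lerDr.
apply: (le_trans (u1C z)).
have zn0 : 0 <= (1 + `|z|) ^+ n by rewrite exprn_ge0// addr_ge0.
apply: (le_trans (ler_wpM2r zn0 (ler_norm C))); apply: ler_wpM2l => //.
by apply: lerXn2r; rewrite ?nnegrE ?addr_ge0// lerD2l.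
Qed.

End taylor.

(** * A comparison principle for the twice differentiated Stein equation *)

Section stein_comparison.
Context {R : realType}.
Local Notation w := (@gauss_weight R).
Local Notation t0 := (@gauss_tail R).
Local Notation t1 := (@gauss_tail1 R).
Local Notation t2 := (@gauss_tail2 R).
Implicit Types (g : R -> R) (x : R).

(** The expression has derivative
[t1 x * (g2 x - x * g1 x - 2 * g x) <= 0], because t1' = - t0, t2' = - 2 * t1
and t2 - t0 = - x * t1, and it tends to 0 at infinity. *)
Lemma half_line_comparison g g1 g2 n : (forall x : R, is_derive x 1 g (g1 x)) ->
  (forall x : R, is_derive x 1 g1 (g2 x)) ->
  poly_growth n g -> poly_growth n g1 ->
  (forall x, g2 x - x * g1 x - 2 * g x <= 0) ->
  forall x, 0 <= g1 x * t1 x + g x * t2 x.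
Proof.
move=> dg dg1 [C gC] [C1 g1C] Lg x.
pose D' x := t1 x * (g2 x - x * g1 x - 2 * g x).
have dD (y : R) : is_derive y 1 (fun x => g1 x * t1 x + g x * t2 x) (D' y).
  have d1 := is_derive_gauss_tail1 y; have d2 := is_derive_gauss_tail2 y.
  by apply: is_derive_eq; rewrite /GRing.scale/= /D' /t2 /t1; ring.
apply: (ge0_of_nincr_cvg0 dD) (lexx x).
  by move=> y _; rewrite mulr_ge0_le0// ltW// gauss_tail1_gt0.
apply: (@cvg0_le_gauss_weight _ _ (2 ^+ n * (2 * `|C1| + 3 * `|C|)) n.+2) => y y1.
have w0 := gauss_weight_gt0 y.
have yn : (1 + `|y|) ^+ n <= 2 ^+ n * y ^+ n.
  rewrite -exprMn; apply: lerXn2r; rewrite ?nnegrE ?ger0_norm; lra.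
have bound (c C' : R) : `|c| <= C' * (1 + `|y|) ^+ n -> `|c| <= `|C'| * (2 ^+ n * y ^+ n).
  move=> /le_trans; apply; apply: (@le_trans _ _ (`|C'| * (1 + `|y|) ^+ n)).
    by apply: (ler_wpM2r _ (ler_norm C')); rewrite exprn_ge0// addr_ge0.
  by rewrite ler_wpM2l.
apply: (le_trans (ler_normD _ _)); rewrite !normrM.
have h1 := ler_pM (normr_ge0 _) (normr_ge0 _) (bound _ _ (g1C y)) (gauss_tail1_le y1).
have h2 := ler_pM (normr_ge0 _) (normr_ge0 _) (bound _ _ (gC y)) (gauss_tail2_le y1).
apply: (le_trans (lerD h1 h2)).
have y2 : y ^+ 1 * w y <= y ^+ 2 * w y by rewrite ler_pM2r// ler_weXn2l.
have c0 : 0 <= `|C1| * (2 ^+ n * y ^+ n).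
  by rewrite mulr_ge0// mulr_ge0// exprn_ge0//; lra.
have h3 := ler_wpM2l c0 y2.
have -> : 2 ^+ n * (2 * `|C1| + 3 * `|C|) * (y ^+ n.+2 * w y) =
   2 * (`|C1| * (2 ^+ n * y ^+ n) * (y ^+ 2 * w y)) +
   `|C| * (2 ^+ n * y ^+ n) * (3 * (y ^+ 2 * w y)) by rewrite !exprS; ring.
lra.
Qed.

(** Apply [half_line_comparison] to [g] and to its reflection, which satisfies
the same inequality. The two results combine linearly: eliminating [g1] gives
[0 <= g], and then, on the half-line where the sign of [x] fits, adding a
multiple of [g x] to [`|x|] times one of them gives the claim, since
[2 * t1 - x * t2] is positive. *)
Lemma second_order_comparison g g1 g2 n : (forall x : R, is_derive x 1 g (g1 x)) ->
  (forall x : R, is_derive x 1 g1 (g2 x)) ->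
  poly_growth n g -> poly_growth n g1 ->
  (forall x, g2 x - x * g1 x - 2 * g x <= 0) ->
  forall x, 0 <= x * g1 x + 2 * g x.
Proof.
move=> dg dg1 ng ng1 Lg x.
have right := half_line_comparison dg dg1 ng ng1 Lg x.
have left : 0 <= - g1 x * t1 (- x) + g x * t2 (- x).
  have d1 (y : R) : is_derive y 1 (fun y => - g1 (- y)) (g2 (- y)).
    have := is_deriveN (is_derive_comp_opp dg1 y); rewrite opprK; exact.
  have := half_line_comparison (is_derive_comp_opp dg) d1
    (poly_growth_oppr ng) (poly_growthN (poly_growth_oppr ng1)) _ (- x).
  rewrite opprK; apply => y; have := Lg (- y); lra.
have a1 := gauss_tail1_gt0 x; have a2 := gauss_tail2_gt0 x.
have a3 := gauss_tail3_gt0 x.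
have b1 := gauss_tail1_gt0 (- x); have b2 := gauss_tail2_gt0 (- x).
have b3 := gauss_tail3_gt0 (- x).
(* Multiply the right inequality by t1 (- x), the left one by t1 x, and add:
   the terms in g1 cancel. *)
have g0 : 0 <= g x.
  have c0 : 0 < t2 x * t1 (- x) + t2 (- x) * t1 x by rewrite addr_gt0// mulr_gt0.
  rewrite -(pmulr_rge0 _ c0).
  have := addr_ge0 (mulr_ge0 right (ltW b1)) (mulr_ge0 left (ltW a1)).
  by move=> /le_trans; apply; rewrite le_eqVlt; apply/orP; left; apply/eqP; ring.
have [x0|/ltW x0] := leP 0 x.
  rewrite -(pmulr_lge0 _ a1).
  have := addr_ge0 (mulr_ge0 x0 right) (mulr_ge0 g0 (ltW a3)).
  by move=> /le_trans; apply; rewrite le_eqVlt; apply/orP; left; apply/eqP; ring.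
rewrite -(pmulr_lge0 _ b1).
have nx0 : 0 <= - x by rewrite oppr_ge0.
have := addr_ge0 (mulr_ge0 nx0 left) (mulr_ge0 g0 (ltW b3)).
by move=> /le_trans; apply; rewrite le_eqVlt; apply/orP; left; apply/eqP; ring.
Qed.

(** The constant [M / 2] turns the two-sided bound on the equation into the
two signs required by [second_order_comparison]. *)
Lemma second_order_estimate g g1 g2 M n :
  (forall x : R, is_derive x 1 g (g1 x)) ->
  (forall x : R, is_derive x 1 g1 (g2 x)) ->
  poly_growth n g -> poly_growth n g1 ->
  (forall x, `|g2 x - x * g1 x - 2 * g x| <= M) ->
  forall x, `|g2 x| <= 2 * M.
Proof.
move=> dg dg1 ng ng1 LgM x.
(* The constant M / 2 is mapped to - M by the operator and to M by x g' + 2 g. *)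
have nM : poly_growth n (cst (M / 2)) := poly_growth_le (leq0n n) (poly_growth_cst _).
have dM (s : R -> R) (s1 : R -> R) (y : R) : is_derive y 1 s (s1 y) ->
    is_derive y 1 (fun z => s z + M / 2) (s1 y).
  by move=> ds; apply: is_derive_eq; rewrite addr0.
have lo : 0 <= x * g1 x + 2 * (g x + M / 2).
  apply: (second_order_comparison (fun y => dM _ _ y (dg y)) dg1 (poly_growthD ng nM) ng1).
  by move=> y; have := LgM y; rewrite ler_norml /cst /= => /andP[]; lra.
have hi : 0 <= x * (- g1 x) + 2 * (- g x + M / 2).
  apply: (@second_order_comparison (fun z => - g z + M / 2) (fun z => - g1 z)
    (fun z => - g2 z) n (fun y => dM _ _ y (is_deriveN (dg y)))
    (fun y => is_deriveN (dg1 y)) (poly_growthD (poly_growthN ng) nM) (poly_growthN ng1)).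
  by move=> y; have := LgM y; rewrite ler_norml /cst /= => /andP[]; lra.
have := LgM x; rewrite !ler_norml => /andP[l1 l2]; apply/andP; split; lra.
Qed.

End stein_comparison.

(** * The solution of the Stein equation *)

Section stein_equation.
Context {R : realType}.
Local Notation lambda := (@lebesgue_measure R).
Local Notation w := (@gauss_weight R).
Local Notation t0 := (@gauss_tail R).
Implicit Types (F k h : R -> R) (a b c x y : R).

(** Expand [h] at 0 to second order. *)
Lemma quadratic_bound h h1 h2 M : (forall x : R, is_derive x 1 h (h1 x)) ->
  (forall x : R, is_derive x 1 h1 (h2 x)) -> (forall x, `|h2 x| <= M) ->
  exists a b, forall x, `|h x| <= a + b * x ^+ 2.
Proof.
move=> dh dh1 h2M; exists (`|h 0| + `|h1 0|), (`|h1 0| + M / 2) => x.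
have := taylor2 0 x dh dh1 h2M; rewrite add0r => hT.
have xx : `|x| <= 1 + x ^+ 2.
  by rewrite ler_norml; have := sqr_ge0 (x - 1); have := sqr_ge0 (x + 1);
    rewrite !expr2; nra.
have := ler_wpM2l (normr_ge0 (h1 0)) xx; rewrite -normrM.
have -> : h x = (h x - h 0 - x * h1 0) + (h 0 + h1 0 * x) by ring.
move=> h3; apply: (le_trans (ler_normD _ _)).
have := ler_normD (h 0) (h1 0 * x); lra.
Qed.

Lemma poly_growth_quadratic k a b : (forall x, `|k x| <= a + b * x ^+ 2) ->
  poly_growth 2 k.
Proof.
move=> kab; have [C hC] : poly_growth 2 (fun x => cst a x + cst b x * (x * x)).
  apply: poly_growthD; first exact: poly_growth_le (poly_growth_cst a).
  apply: (poly_growthM (poly_growth_cst b)).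
  exact: (poly_growthM poly_growth_id poly_growth_id).
exists C => x; apply: le_trans (hC x); rewrite -expr2.
exact: le_trans (kab x) (ler_norm _).
Qed.

Lemma cvg_mul_gauss_weight : (x * w x) @[x --> +oo] --> (0 : R).
Proof.
apply: (@cvg0_le_gauss_weight _ _ 1 1) => x x1.
by rewrite mul1r expr1 ger0_norm// mulr_ge0// ?ltW ?gauss_weight_gt0//; lra.
Qed.

(** The majorant is a combination of [t0] and [x * w x] whose derivative is
exactly [- (a + b * x ^+ 2) * w x]. *)
Lemma weighted_primitive_le F k a b :
  (forall x : R, is_derive x 1 F (k x * w x)) ->
  (forall x, `|k x| <= a + b * x ^+ 2) -> F x @[x --> +oo] --> (0 : R) ->
  forall x, `|F x| <= (a + b) * t0 x + b * (x * w x).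
Proof.
move=> dF kab F0.
have step (s x : R) : s = 1 \/ s = -1 ->
    0 <= (a + b) * t0 x + b * (x * w x) + s * F x.
  move=> s1.
  pose D' y := - (a + b * y ^+ 2 - s * k y) * w y.
  have dD (y : R) :
      is_derive y 1 (fun x => (a + b) * t0 x + b * (x * w x) + s * F x) (D' y).
    have d0 := is_derive_gauss_tail y; have d := is_derive_gauss_weight y.
    have dFy := dF y.
    by apply: is_derive_eq; rewrite /GRing.scale/= /D'; ring.
  apply: (ge0_of_nincr_cvg0 dD) (lexx x) => [y _|].
    have w0 := gauss_weight_gt0 y; rewrite /D' mulNr oppr_le0; apply: mulr_ge0 (ltW w0).
    have := kab y; rewrite ler_norml => /andP[? ?]; case: s1 => ->; lra.
  have cM (q : R) (u : R -> R) : u x @[x --> +oo] --> (0 : R) -> q * u x @[x --> +oo] --> (0 : R).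
    by move=> u0; rewrite -(mulr0 q); apply: cvgM u0; exact: cvg_cst.
  have cD (u v : R -> R) : u x @[x --> +oo] --> (0 : R) ->
      v x @[x --> +oo] --> (0 : R) -> u x + v x @[x --> +oo] --> (0 : R).
    by move=> u0 v0; rewrite -(addr0 0); apply: cvgD.
  apply: (cD _ _ _ (cM s F F0)).
  exact: (cD _ _ (cM (a + b) _ (@cvg_gauss_tail R)) (cM b _ cvg_mul_gauss_weight)).
move=> x; have := step 1 x (or_introl erefl); have := step (-1) x (or_intror erefl).
by rewrite ler_norml => ? ?; apply/andP; split; lra.
Qed.

Lemma gauss_tail_le_weight : exists2 K : R, 0 <= K & forall x, 0 <= x -> t0 x <= K * w x.
Proof.
have w1 := @gauss_weight_gt0 R 1; have t00 := @gauss_tail_gt0 R 0.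
exists (1 + t0 0 / w 1); first by rewrite addr_ge0// divr_ge0// ltW.
move=> x x0; have wx := gauss_weight_gt0 x.
have [x1|x1] := leP 1 x.
  apply: (le_trans (gauss_tail_le x1)); rewrite ler_peMl ?ltW//.
  by rewrite ltrDl divr_gt0.
have [z _ zt] := MVT_le x0 (@is_derive_gauss_tail R).
have wz := gauss_weight_gt0 z.
have tx : t0 x <= t0 0 by nra.
have ww : w 1 <= w x by rewrite ler_expR; nra.
apply: (le_trans tx); rewrite mulrDl mul1r.
have : t0 0 <= t0 0 / w 1 * w x.
  by rewrite -mulrA ler_pMr// ler_pdivlMl ?mulr1.
lra.
Qed.

(** On each half-line, [F] is controlled by the tail on the same side, whence
the limits at both ends. *)
Lemma poly_growth_weighted_primitive F k a b :
  (forall x : R, is_derive x 1 F (k x * w x)) ->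
  (forall x, `|k x| <= a + b * x ^+ 2) ->
  F x @[x --> +oo] --> (0 : R) -> F x @[x --> -oo] --> (0 : R) ->
  poly_growth 1 (fun x => F x / w x).
Proof.
move=> dF kab Fy FNy; have [K K0 tK] := gauss_tail_le_weight.
have ab0 : 0 <= a + b.
  by have := le_trans (normr_ge0 _) (kab 1); rewrite expr1n mulr1.
set C := (a + b) * K + `|b|.
have half G l : (forall x : R, is_derive x 1 G (l x * w x)) ->
    (forall x, `|l x| <= a + b * x ^+ 2) -> G x @[x --> +oo] --> (0 : R) ->
    forall x, 0 <= x -> `|G x| / w x <= C * (1 + x).
  move=> dG lab Gy x x0; have wx := gauss_weight_gt0 x.
  rewrite ler_pdivrMr//; apply: (le_trans (weighted_primitive_le dG lab Gy x)).
  have h1 := ler_wpM2l ab0 (tK x x0).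
  have h2 : b * (x * w x) <= `|b| * (x * w x).
    by apply: (ler_wpM2r _ (ler_norm b)); rewrite mulr_ge0// ltW.
  apply: (le_trans (lerD h1 h2)).
  have h3 : 0 <= (a + b) * K * x * w x by rewrite !mulr_ge0// ltW.
  have h4 : 0 <= `|b| * w x by rewrite mulr_ge0// ltW.
  rewrite /C; lra.
exists C => x; rewrite expr1 normrM normfV (gtr0_norm (gauss_weight_gt0 x)).
have [x0|/ltW x0] := leP 0 x; first by rewrite (ger0_norm x0); exact: half.
rewrite (ler0_norm x0) -(gauss_weightN x) -normrN -[in F x](opprK x).
apply: (half (fun y => - F (- y)) (fun y => k (- y))); last by rewrite oppr_ge0.
- move=> y; have := is_deriveN (is_derive_comp_opp dF y).
  by rewrite opprK gauss_weightN; exact.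
- by move=> y; have := kab (- y); rewrite sqrrN.
- rewrite -oppr0; apply: cvgN; exact: (cvgNy_compNP F (nbhs (0 : R))).1 FNy.
Qed.

(** All derivatives of the solution are read off the equation itself, so that
the third one exists wherever [h2] does. The centering hypothesis on [c] makes the
weighted primitive vanish at infinity on the right as well as on the left. *)
Lemma stein_solution h h1 h2 M c :
  (forall x : R, is_derive x 1 h (h1 x)) ->
  (forall x : R, is_derive x 1 h1 (h2 x)) -> (forall x, `|h2 x| <= M) ->
  (\int[lambda]_x ((h x - c) * w x))%R = 0 ->
  exists f f1 f2 f3 : R -> R,
  [/\ forall x : R, is_derive x 1 f (f1 x),
      forall x : R, is_derive x 1 f1 (f2 x),
      forall x : R, is_derive x 1 f2 (f3 x),
      forall x, f1 x - x * f x = h x - c &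
      forall x, `|f3 x| <= 2 * M].
Proof.
move=> dh dh1 h2M hc.
have [a [b hab]] := quadratic_bound dh dh1 h2M.
pose k x := h x - c.
have kab x : `|k x| <= (a + `|c|) + b * x ^+ 2.
  by apply: (le_trans (ler_normB _ _)); have := hab x; lra.
have dk (x : R) : is_derive x 1 k (h1 x).
  by have := dh x => ?; apply: is_derive_eq; rewrite subr0.
have ck : continuous k := is_derive_continuous dk.
have cw := is_derive_continuous (@is_derive_gauss_weight R).
have ikw := integrable_mul_gauss_weight ck kab.
pose F x := (\int[lambda]_(t in `]-oo, x]) (k t * w t))%R.
have dF (x : R) : is_derive x 1 F (k x * w x).
  apply: is_derive_integral_itvNy ikw x => x; exact: cvgM (ck x) (cw x).
have Fy : F x @[x --> +oo] --> (0 : R).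
  by have := cvg_integral_itvNyy ikw; rewrite hc; exact.
have FNy := cvg_integral_itvNyNy ikw.
have gf := poly_growth_weighted_primitive dF kab Fy FNy.
pose f x := F x / w x.
pose f1 x := x * f x + k x.
pose f2 x := f x + x * f1 x + h1 x.
(* The equation and its first two derivatives, solved for the highest order. *)
pose f3 x := 2 * f1 x + x * f2 x + h2 x.
have df (x : R) : is_derive x 1 f (f1 x).
  have w0 := gauss_weight_gt0 x.
  have wn0 : w x != 0 by rewrite gt_eqF.
  have dFx := dF x; have dw := is_derive_gauss_weight x.
  have dV := is_deriveV wn0 dw.
  have dM := is_deriveM dFx dV.
  by apply: (is_derive_eq dM); rewrite /GRing.scale/= /f1 /f; field.
have df1 (x : R) : is_derive x 1 f1 (f2 x).
  have := df x; have := dk x => ? ?.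
  by apply: is_derive_eq; rewrite /GRing.scale/= /f2; ring.
have df2 (x : R) : is_derive x 1 f2 (f3 x).
  have := df x; have := df1 x; have := dh1 x => ? ? ?.
  by apply: is_derive_eq; rewrite /GRing.scale/= /f3; ring.
exists f, f1, f2, f3; split => //; first by move=> x; rewrite /f1 /k; ring.
have gf1 : poly_growth 2 f1.
  by apply: poly_growthD (poly_growth_quadratic kab); exact: (poly_growthM poly_growth_id gf).
have gh1 : poly_growth 1 h1 := poly_growth_primitive dh1 (poly_growth_bounded h2M).
have gf2 : poly_growth 3 f2.
  apply: poly_growthD; last exact: poly_growth_le gh1.
  apply: poly_growthD; first exact: poly_growth_le gf.
  exact: (poly_growthM poly_growth_id gf1).
apply: (second_order_estimate df1 df2 (poly_growth_le _ gf1) gf2) => // x.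
by have -> : f3 x - x * f2 x - 2 * f1 x = h2 x by rewrite /f3; ring.
Qed.

End stein_equation.

(** * Pairs of independent random variables *)

Section independence.
Context d (T : measurableType d) (R : realType) (P : probability T R).
Implicit Types (X Y : {RV P >-> R}) (u v : R -> R).

Definition independent X Y := forall A B : set (measurableTypeR R),
  measurable A -> measurable B ->
  P (X @^-1` A `&` Y @^-1` B) = (P (X @^-1` A) * P (Y @^-1` B))%E.

Lemma sum_RVE (I : eqType) (X : I -> {RV P >-> R}) (s : seq I) w :
  (\sum_(j <- s) X j : {mfun T >-> R}) w = \sum_(j <- s) X j w.
Proof.
elim: s => [|j s IH]; first by rewrite !big_nil.
by rewrite !big_cons /= -IH.
Qed.

Definition joint X Y : T -> R * R := fun w => (X w, Y w).

Lemma measurable_joint X Y : measurable_fun setT (joint X Y).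
Proof. exact: measurable_fun_pair. Qed.

Definition jointRV X Y :=
  mfun_Sub (mem_set (measurable_joint X Y)).

(** Rectangles determine a measure on the plane. *)
Lemma joint_law X Y : independent X Y -> forall A, measurable A ->
  (distribution P X \x distribution P Y)%E A = distribution P (jointRV X Y) A.
Proof.
move=> XY; apply: product_measure_unique => A B mA mB.
exact: XY.
Qed.


Lemma integrable_indepM X Y u v : independent X Y ->
  measurable_fun setT u -> measurable_fun setT v ->
  P.-integrable setT (EFin \o (u \o X)) -> P.-integrable setT (EFin \o (v \o Y)) ->
  P.-integrable setT (EFin \o (fun w => u (X w) * v (Y w))).
Proof.
move=> XY mu mv iu iv.
have mX : measurable_fun setT X by [].
have mY : measurable_fun setT Y by [].
apply/integrableP; split.
  apply/measurable_EFinP; apply: measurable_funM; exact: measurableT_comp.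
pose f (z : R * R) := (`|u z.1| * `|v z.2|)%:E.
have mf : measurable_fun setT f.
  apply/measurable_EFinP; apply: measurable_funM.
  - by apply: measurableT_comp => //; exact: (measurableT_comp mu measurable_fst).
  - by apply: measurableT_comp => //; exact: (measurableT_comp mv measurable_snd).
have f0 z : (0 <= f z)%E by rewrite lee_fin mulr_ge0.
rewrite (_ : (\int[P]_w _ = \int[distribution P (jointRV X Y)]_z f z)%E); last first.
  rewrite ge0_integral_distribution//; apply: eq_integral => w _.
  by rewrite /= normrM.
rewrite -(eq_measure_integral _ (fun A mA _ => joint_law XY mA)).
rewrite fubini_tonelli1//.
have abs_lty (Z : {RV P >-> R}) q : measurable_fun setT q ->
    P.-integrable setT (EFin \o (q \o Z)) ->
    (\int[distribution P Z]_x `|q x|%:E < +oo)%E.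
  move=> mq iq; rewrite ge0_integral_distribution//.
    by have /integrableP[] := iq.
  by apply/measurable_EFinP; exact: measurableT_comp.
rewrite (eq_integral (fun x => (`|u x|%:E * \int[distribution P Y]_y `|v y|%:E)%E)).
  rewrite ge0_integralZr//; last 2 first.
  - by apply/measurable_EFinP; exact: measurableT_comp.
  - exact: integral_ge0.
  apply: lte_mul_pinfty; [exact: integral_ge0| |exact: abs_lty].
  by rewrite ge0_fin_numE ?abs_lty//; exact: integral_ge0.
move=> x _; rewrite /fubini_F /f /= -ge0_integralZl//.
by apply/measurable_EFinP; exact: measurableT_comp.
Qed.

Lemma expectation_indepM X Y u v : independent X Y ->
  measurable_fun setT u -> measurable_fun setT v ->
  P.-integrable setT (EFin \o (u \o X)) -> P.-integrable setT (EFin \o (v \o Y)) ->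
  (\int[P]_w (u (X w) * v (Y w)) = \int[P]_w u (X w) * \int[P]_w v (Y w))%R.
Proof.
move=> XY mu mv iu iv.
have iuv := integrable_indepM XY mu mv iu iv.
pose f (z : R * R) := (u z.1 * v z.2)%:E.
have mf : measurable_fun setT f.
  apply/measurable_EFinP; apply: measurable_funM.
  - exact: (measurableT_comp mu measurable_fst).
  - exact: (measurableT_comp mv measurable_snd).
have jf : (distribution P X \x distribution P Y)%E.-integrable setT f.
  have jf' : (distribution P (jointRV X Y)).-integrable setT f.
    exact: integrable_pushforward.
  apply/integrableP; split => //.
  rewrite (eq_measure_integral _ (fun A mA _ => joint_law XY mA)).
  by have /integrableP[] := jf'.
rewrite /Rintegral -fineM; first congr fine.
- transitivity (\int[distribution P (jointRV X Y)]_z f z)%E.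
    by rewrite integral_distribution.
  rewrite -(eq_measure_integral _ (fun A mA _ => joint_law XY mA)).
  rewrite -integral12_prod_meas1//.
  have ivY : (distribution P Y).-integrable setT (EFin \o v).
    by apply: integrable_pushforward => //; exact/measurable_EFinP.
  have iuX : (distribution P X).-integrable setT (EFin \o u).
    by apply: integrable_pushforward => //; exact/measurable_EFinP.
  rewrite (eq_integral (fun x => ((u x)%:E * (\int[P]_w v (Y w))%:E)%E)).
    rewrite integralZr// integral_distribution//; last exact/measurable_EFinP.
    by rewrite [in LHS]/Rintegral fineK//; exact: integrable_fin_num.
  move=> x _; rewrite /fubini_F /f /=.
  under eq_integral do rewrite EFinM.
  rewrite integralZl// integral_distribution//; last exact/measurable_EFinP.
  by rewrite /Rintegral fineK//; exact: integrable_fin_num.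
- exact: integrable_fin_num.
- exact: integrable_fin_num.
Qed.

Lemma pow4_le (x y : R) : (x - y) ^+ 4 <= 8 * (x ^+ 4 + y ^+ 4).
Proof.
have -> : 8 * (x ^+ 4 + y ^+ 4) =
    (x - y) ^+ 4 + (((x + y) ^+ 2) ^+ 2 + 6 * ((x - y) * (x + y)) ^+ 2) by ring.
by rewrite lerDl addr_ge0 ?sqr_ge0// mulr_ge0 ?sqr_ge0.
Qed.

(** By Fubini, for some fixed value [y] of [Y] the variable [(X + y) ^+ 4] is
integrable, and a constant shift does not affect integrability. *)
Lemma integrable_indep_summand X Y : independent X Y ->
  P.-integrable setT (EFin \o (fun w => (X w + Y w) ^+ 4)) ->
  P.-integrable setT (EFin \o (fun w => X w ^+ 4)).
Proof.
move=> XY iXY.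
pose f (z : R * R) := ((z.1 + z.2) ^+ 4)%:E.
have mf : measurable_fun setT f.
  apply/measurable_EFinP; apply: measurable_funX; apply: measurable_funD.
  - exact: measurable_fst.
  - exact: measurable_snd.
have jf : (distribution P X \x distribution P Y)%E.-integrable setT f.
  have jf' : (distribution P (jointRV X Y)).-integrable setT f.
    exact: integrable_pushforward.
  apply/integrableP; split => //.
  rewrite (eq_measure_integral _ (fun A mA _ => joint_law XY mA)).
  by have /integrableP[] := jf'.
have [y iy] : exists y, (distribution P X).-integrable setT (fun x => f (x, y)).
  have PY : (0 < distribution P Y setT)%E by rewrite probability_setT.
  have aeP := ae_properfilter_algebraOfSetsType PY.
  by have /filter_ex[y] := ae_integrable2 jf; exists y.
have ix : P.-integrable setT (EFin \o (fun w => (X w + y) ^+ 4)).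
  apply/integrableP; split.
    apply/measurable_EFinP; apply: measurable_funX; exact: measurable_funD.
  have /integrableP[mfy] := iy; rewrite ge0_integral_distribution//.
  exact: measurableT_comp.
have iy4 : P.-integrable setT (EFin \o (cst (y ^+ 4))).
  exact: finite_measure_integrable_cst.
have i8 := integrableZl measurableT 8 (integrableD measurableT ix iy4).
apply: le_integrable i8 => //.
  by apply/measurable_EFinP; apply: measurable_funX.
move=> w _ /=; rewrite lee_fin.
have p40 (z : R) : 0 <= z ^+ 4 by rewrite exprn_even_ge0.
rewrite ger0_norm ?p40// ger0_norm; last by apply: mulr_ge0 => //; exact: addr_ge0.
by have := pow4_le (X w + y) y; rewrite addrK.
Qed.

End independence.

(** * Partial sums of an independent family *)

Section sums_of_independent.
Context d (T : measurableType d) (R : realType) (P : probability T R).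
Variables (n : nat) (X : 'I_n -> {RV P >-> R}).
Hypothesis iX : mutually_independent X.

Definition sumRV (s : seq 'I_n) : {RV P >-> R} :=
  (\sum_(j <- s) X j : {mfun T >-> R}).

(** Intersections of events, one for each variable other than [X i]. They form
a pi-system, on which independence from [X i] is the product rule; it
extends to the sigma-algebra that they generate. *)
Let others i : set (set T) := [set E | exists2 A : 'I_n -> set (measurableTypeR R),
  forall j, measurable (A j) &
  E = \bigcap_(j in [set` [set~ i]%SET]) (X j @^-1` A j)].

Let others_measurable i : others i `<=` measurable.
Proof.
move=> _ [A mA ->]; apply: fin_bigcap_measurable => //= j _.
exact: (measurable_funPTI (X j) (mA j)).
Qed.

Let others_setI i : setI_closed (others i).
Proof.
move=> _ _ [A mA ->] [B mB ->].
exists (fun j => A j `&` B j); first by move=> j; exact: measurableI.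
by rewrite -bigcapI.
Qed.

Let others_setT i : others i setT.
Proof.
exists (fun=> setT) => //; apply/esym; rewrite -subTset => w _ j _.
by [].
Qed.

Let indep_others i A E : measurable A -> <<s others i >> E ->
  P (X i @^-1` A `&` E) = (P (X i @^-1` A) * P E)%E.
Proof.
move=> mA.
have mXA : measurable (X i @^-1` A).
  exact: (measurable_funPTI (X i) mA).
have PXA : P (X i @^-1` A) \is a fin_num by rewrite fin_num_measure.
pose r : {nonneg R} := NngNum (fine_ge0 (measure_ge0 P (X i @^-1` A))).
have rE : r%:num%:E = P (X i @^-1` A) by rewrite /= fineK.
move=> sE; suff : mrestr P mXA E = mscale r P E.
  by rewrite /mrestr /mscale rE setIC.
apply: (@g_sigma_algebra_measure_unique _ _ _ (others i) (@others_measurable i)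
  (fun=> setT) (fun=> others_setT i) _ (mrestr P mXA) (mscale r P)
  (@others_setI i)) => //.
- by rewrite bigcup_const.
- move=> _ [B mB ->]; rewrite /mrestr /mscale rE.
  (* Put the event on X i back among the others, to use the product rule twice. *)
  pose C j := if j == i then A else B j.
  have mC j : measurable (C j : set (measurableTypeR R)).
    by rewrite /C; case: ifP => _; [exact: mA|exact: mB].
  have := iX [set: 'I_n]%SET mC; have := iX [set~ i]%SET mC.
  have CB : \bigcap_(j in [set` [set~ i]%SET]) (X j @^-1` C j) =
            \bigcap_(j in [set` [set~ i]%SET]) (X j @^-1` B j).
    apply: eq_bigcapr => j /=; rewrite !inE => ji.
    by rewrite /C (negbTE ji).
  have Ci : C i = A by rewrite /C eqxx.
  rewrite CB => PB; rewrite (bigD1 i) ?inE// Ci => PA.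
  transitivity (P (X i @^-1` A) *
    \prod_(j in [set~ i]%SET) P (X j @^-1` C j))%E; last first.
    by congr (_ * _)%E; [exact: esym rE|exact: esym PB].
  transitivity (P (\bigcap_(j in [set` [set: 'I_n]%SET]) (X j @^-1` C j))).
    congr (P _); rewrite -CB eqEsubset; split => [w [wB wA] j _|w wC].
      have [->|ji] := eqVneq j i; first by rewrite /= Ci.
      by apply: wB; rewrite /= !inE.
    split; first by move=> j _; apply: wC; rewrite /= inE.
    by have := wC i; rewrite /= inE Ci; exact.
  rewrite PA; congr (_ * _)%E; apply: eq_bigl => j; by rewrite !inE.
- move=> _; rewrite -[ltLHS]/(P (setT `&` X i @^-1` A)) setTI.
  exact: (le_lt_trans (probability_le1 P mXA) (ltry 1)).
Qed.

(** The partial sum is measurable for the sigma-algebra generated by the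
variables other than [X i]. *)
Lemma independent_sumRV i (s : seq 'I_n) : i \notin s -> independent (X i) (sumRV s).
Proof.
move=> si A B mA mB; apply: indep_others => //.
pose TT := g_sigma_algebraType (others i).
have mj j : j != i -> measurable_fun setT (X j : TT -> R).
  move=> ji _ C mC; rewrite setTI; apply: sub_sigma_algebra.
  exists (fun k => if k == j then C else setT).
    by move=> k; case: ifP => _; [exact: mC|exact: measurableT].
  rewrite eqEsubset; split => [w wC k _ /=|w]; first by case: eqP => [->|].
  by move=> wI; have := wI j; rewrite /= eqxx !inE; exact.
have ms : measurable_fun setT (fun w : TT => \sum_(j <- s) X j w).
  elim: s si => [_|j s IH]; first by under eq_fun do rewrite big_nil; exact: measurable_cst.
  rewrite inE negb_or eq_sym => /andP[ji /IH ms].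
  under eq_fun do rewrite big_cons.
  by apply: measurable_funD => //; exact: mj.
have := ms measurableT B mB; rewrite setTI.
by under eq_fun do rewrite -sum_RVE.
Qed.

End sums_of_independent.

(** * Integrability and moments *)

Section real_expectation.
Context d (T : measurableType d) (R : realType) (P : probability T R).
Implicit Types (u v : T -> R) (X Y : {RV P >-> R}) (g : R -> R) (m n : nat).
Local Notation integ u := (P.-integrable setT (EFin \o u)).

Lemma integD u v : integ u -> integ v -> integ (fun w => u w + v w).
Proof. exact: integrableD. Qed.

Lemma integZ a u : integ u -> integ (fun w => a * u w).
Proof. exact: integrableZl. Qed.

Lemma integB u v : integ u -> integ v -> integ (fun w => u w - v w).
Proof. exact: integrableB. Qed.

Lemma integ_cst (a : R) : integ (cst a).
Proof. exact: finite_measure_integrable_cst. Qed.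

Lemma integ_sum (I : Type) (s : seq I) (F : I -> T -> R) :
  (forall i, integ (F i)) -> integ (fun w => \sum_(i <- s) F i w).
Proof.
move=> iF; elim: s => [|i s IH].
  by under eq_fun do rewrite big_nil; exact: integ_cst.
by under eq_fun do rewrite big_cons; exact: integD.
Qed.

Lemma Rintegral_sum (I : Type) (s : seq I) (F : I -> T -> R) :
  (forall i, integ (F i)) ->
  (\int[P]_w (\sum_(i <- s) F i w) = \sum_(i <- s) \int[P]_w F i w)%R.
Proof.
move=> iF; elim: s => [|i s IH].
  rewrite big_nil; under eq_Rintegral do rewrite big_nil.
  by rewrite Rintegral_cst// mul0r.
rewrite big_cons -IH -RintegralD//; last exact: integ_sum.
by apply: eq_Rintegral => w _; rewrite big_cons.
Qed.

Lemma integ_le u v : measurable_fun setT u -> integ v ->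
  (forall w, `|u w| <= v w) -> integ u.
Proof.
move=> mu iv uv; apply: le_integrable iv => //; first exact/measurable_EFinP.
by move=> w _; rewrite /= lee_fin (le_trans (uv w))// ler_norm.
Qed.

Lemma Rintegral_norm_le u v : integ u -> integ v ->
  (forall w, `|u w| <= v w) -> `|\int[P]_w u w|%R <= (\int[P]_w v w)%R.
Proof.
move=> iu iv uv; apply: (le_trans (le_normr_Rintegral measurableT iu)).
by apply: le_Rintegral => //; exact: integrable_norm.
Qed.

Lemma integ_poly_growth X n g : (n <= 4)%N -> measurable_fun setT g ->
  poly_growth n g -> integ (fun w => X w ^+ 4) -> integ (fun w => g (X w)).
Proof.
move=> n4 mg /(poly_growth_le n4)[C gC] iX4.
have i1 : integ (fun w => `|C| * (8 * (cst 1 w + X w ^+ 4))).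
  exact: (integZ _ (integZ _ (integD (integ_cst 1) iX4))).
apply: integ_le i1 _; first exact: measurableT_comp.
move=> w; apply: (le_trans (gC (X w))).
have x0 : 0 <= (1 + `|X w|) ^+ 4 by rewrite exprn_ge0// addr_ge0.
apply: (le_trans (ler_wpM2r x0 (ler_norm C))); apply: ler_wpM2l => //.
have := pow4_le 1 (- `|X w|); rewrite opprK expr1n exprNn -normrX.
have -> : (-1) ^+ 4 = 1 :> R by rewrite -signr_odd.
by rewrite mul1r (ger0_norm (_ : 0 <= X w ^+ 4))// exprn_even_ge0.
Qed.

Lemma integ_exp X m : (m <= 4)%N -> integ (fun w => X w ^+ 4) ->
  integ (fun w => X w ^+ m).
Proof.
move=> m4; apply: (@integ_poly_growth X m (fun x => x ^+ m) m4).
  exact: measurable_funX.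
exists 1 => x; rewrite mul1r normrX.
by apply: lerXn2r; rewrite ?nnegrE ?addr_ge0// lerDr.
Qed.

(** The binomial theorem, integrated term by term. *)
Lemma expectation_indep_expD X Y m : independent X Y -> (m <= 4)%N ->
  integ (fun w => X w ^+ 4) -> integ (fun w => Y w ^+ 4) ->
  (\int[P]_w ((X w + Y w) ^+ m) = \sum_(i < m.+1)
    (\int[P]_w (X w ^+ (m - i)) * \int[P]_w (Y w ^+ i)) *+ 'C(m, i))%R.
Proof.
move=> XY m4 iX iY.
have iXi (i : 'I_m.+1) : integ (fun w => X w ^+ (m - i)).
  by apply: integ_exp => //; rewrite (leq_trans (leq_subr _ _)).
have iYi (i : 'I_m.+1) : integ (fun w => Y w ^+ i).
  by apply: integ_exp => //; rewrite -ltnS (leq_trans (ltn_ord i)).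
have mx k : measurable_fun setT (fun x : R => x ^+ k) by exact: measurable_funX.
have iXY (i : 'I_m.+1) : integ (fun w => X w ^+ (m - i) * Y w ^+ i).
  exact: (integrable_indepM XY (mx _) (mx _) (iXi i) (iYi i)).
transitivity (\int[P]_w (\sum_(i < m.+1) ('C(m, i))%:R * (X w ^+ (m - i) * Y w ^+ i)))%R.
  apply: eq_Rintegral => w _; rewrite exprDn; apply: eq_bigr => i _.
  by rewrite mulr_natl.
rewrite Rintegral_sum; last by move=> i; exact: integZ.
apply: eq_bigr => i _; rewrite RintegralZl// mulr_natl; congr (_ *+ _).
exact: (expectation_indepM XY (mx _) (mx _) (iXi i) (iYi i)).
Qed.

End real_expectation.

(** * Moments of sums of independent variables with equal moments *)

Section iid_moments.
Context d (T : measurableType d) (R : realType) (P : probability T R).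
Variables (n : nat) (X : 'I_n -> {RV P >-> R}).
Local Notation integ u := (P.-integrable setT (EFin \o u)).
Local Notation mom Y k := (\int[P]_w (Y w ^+ k))%R.
Hypothesis iX : mutually_independent X.
Hypothesis iX4 : forall i, integ (fun w => X i w ^+ 4).

Lemma sumRV_cons i s w : sumRV X (i :: s) w = X i w + sumRV X s w.
Proof. by rewrite /sumRV !sum_RVE big_cons. Qed.

Lemma sumRV_nil w : sumRV X [::] w = 0.
Proof. by rewrite /sumRV sum_RVE big_nil. Qed.

Lemma mom0 (Y : {RV P >-> R}) : mom Y 0 = 1.
Proof.
under eq_Rintegral do rewrite expr0.
by rewrite Rintegral_cst// mul1r; exact: (congr1 fine (probability_setT P)).
Qed.

Lemma integ_sumRV s : integ (fun w => sumRV X s w ^+ 4).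
Proof.
elim: s => [|i s IH].
  under eq_fun do rewrite sumRV_nil expr0n; exact: integ_cst.
under eq_fun do rewrite sumRV_cons.
apply: (@integ_le _ _ _ P _ (fun w => 8 * (X i w ^+ 4 + sumRV X s w ^+ 4))).
- by apply: measurable_funX; exact: measurable_funD.
- exact: (integZ _ (integD (iX4 i) IH)).
- move=> w; rewrite ger0_norm ?exprn_even_ge0//.
  have := pow4_le (X i w) (- sumRV X s w); rewrite opprK.
  by have -> : (- sumRV X s w) ^+ 4 = sumRV X s w ^+ 4 by ring.
Qed.

Section equal_moments.
Variables v m3 m4 : R.
Hypotheses (X1 : forall i, mom (X i) 1 = 0) (X2 : forall i, mom (X i) 2 = v)
  (X3 : forall i, mom (X i) 3 = m3) (X4 : forall i, mom (X i) 4 = m4).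

(** Additivity of the first four cumulants, for centered variables. The term
in [v ^+ 2] counts the pairs of distinct indices in the fourth power. *)
Lemma moments_sumRV s : uniq s ->
  [/\ mom (sumRV X s) 1 = 0,
      mom (sumRV X s) 2 = (size s)%:R * v,
      mom (sumRV X s) 3 = (size s)%:R * m3 &
      mom (sumRV X s) 4 =
        (size s)%:R * m4 + 3 * (size s)%:R * ((size s)%:R - 1) * v ^+ 2].
Proof.
elim: s => [_|i s IH /= /andP[iNs us]].
  have m0 k : (0 < k)%N -> mom (sumRV X [::]) k = 0.
    move=> k0; under eq_Rintegral do rewrite sumRV_nil expr0n (gtn_eqF k0).
    by rewrite Rintegral_cst// mul0r.
  by rewrite !m0// /=; split; ring.
have [S1 S2 S3 S4] := IH us.
have indep := independent_sumRV iX iNs.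
have sumE k : mom (sumRV X (i :: s)) k = (\int[P]_w ((X i w + sumRV X s w) ^+ k))%R.
  by apply: eq_Rintegral => w _; rewrite sumRV_cons.
rewrite !sumE !(expectation_indep_expD indep) ?integ_sumRV//.
rewrite !big_ord_recl !big_ord0 /= /bump /= !subn0 !subnn.
rewrite !bin0 !binn.
rewrite !addn0 !add1n !subSS !subn0 !bin1 (_ : 'C(3, 2) = 3%N)//.
rewrite (_ : 'C(4, 2) = 6%N)// (_ : 'C(4, 3) = 4%N)//.
rewrite !mom0 S1 S2 S3 S4 X1 X2 X3 X4 -[in (size s).+1]addn1 natrD.
by split; ring.
Qed.

End equal_moments.
End iid_moments.

(** * The Stein identity for sums of independent variables *)

Section stein_for_sums.
Context d (T : measurableType d) (R : realType) (P : probability T R).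
Variables (n : nat) (X : 'I_n -> {RV P >-> R}).
Local Notation integ u := (P.-integrable setT (EFin \o u)).
Local Notation mom Y k := (\int[P]_w (Y w ^+ k))%R.
Hypothesis iX : mutually_independent X.
Hypothesis iX4 : forall i, integ (fun w => X i w ^+ 4).
Variables v m4 : R.
Hypotheses (X1 : forall i, mom (X i) 1 = 0) (X2 : forall i, mom (X i) 2 = v)
  (X3 : forall i, mom (X i) 3 = 0) (X4 : forall i, mom (X i) 4 = m4).
Variables (f f1 f2 f3 : R -> R) (K : R).
Hypotheses (df : forall x : R, is_derive x 1 f (f1 x))
  (df1 : forall x : R, is_derive x 1 f1 (f2 x))
  (df2 : forall x : R, is_derive x 1 f2 (f3 x))
  (f3K : forall x, `|f3 x| <= K).

Let S := sumRV X (index_enum 'I_n).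
Let rest i := sumRV X [seq j <- index_enum 'I_n | j != i].

Lemma sumRV_rest i w : S w = X i w + rest i w.
Proof. by rewrite /S /rest /sumRV !sum_RVE (bigD1 i)//= big_filter. Qed.

Let indep_rest i : independent (X i) (rest i).
Proof. by rewrite /rest; apply: (independent_sumRV iX); rewrite mem_filter /= eqxx. Qed.

Let mf : measurable_fun setT f.
Proof. by apply: continuous_measurable_fun; exact: (is_derive_continuous df). Qed.
Let mf1 : measurable_fun setT f1.
Proof. by apply: continuous_measurable_fun; exact: (is_derive_continuous df1). Qed.
Let mf2 : measurable_fun setT f2.
Proof. by apply: continuous_measurable_fun; exact: (is_derive_continuous df2). Qed.

Let gf2 : poly_growth 1 f2.
Proof. exact: poly_growth_primitive df2 (poly_growth_bounded f3K). Qed.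
Let gf1 : poly_growth 2 f1. Proof. exact: poly_growth_primitive df1 gf2. Qed.
Let gf : poly_growth 3 f. Proof. exact: poly_growth_primitive df gf1. Qed.

Let iS s : integ (fun w => sumRV X s w ^+ 4). Proof. exact: integ_sumRV. Qed.

Let integ_f s : integ (fun w => f (sumRV X s w)).
Proof. exact: integ_poly_growth (isT : 3 <= 4)%N mf gf (iS s). Qed.
Let integ_f1 s : integ (fun w => f1 (sumRV X s w)).
Proof. exact: integ_poly_growth (isT : 2 <= 4)%N mf1 gf1 (iS s). Qed.
Let integ_f2 s : integ (fun w => f2 (sumRV X s w)).
Proof. exact: integ_poly_growth (isT : 1 <= 4)%N mf2 gf2 (iS s). Qed.

Let mexp k : measurable_fun setT (fun x : R => x ^+ k).
Proof. exact: measurable_funX. Qed.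

Let iexp i k : (k <= 4)%N -> integ (fun w => X i w ^+ k).
Proof. by move=> k4; exact: integ_exp. Qed.

Let integ_prod i k g : (k <= 4)%N -> measurable_fun setT g ->
  integ (fun w => g (rest i w)) -> integ (fun w => X i w ^+ k * g (rest i w)).
Proof.
move=> k4 mg ig; exact: (integrable_indepM (@indep_rest i) (mexp k) mg (iexp i k4) ig).
Qed.

Let exp_prod i k g q : mom (X i) k = q -> (k <= 4)%N ->
  measurable_fun setT g -> integ (fun w => g (rest i w)) ->
  (\int[P]_w (X i w ^+ k * g (rest i w)) = q * \int[P]_w g (rest i w))%R.
Proof.
move=> <- k4 mg ig.
exact: (expectation_indepM (@indep_rest i) (mexp k) mg (iexp i k4) ig).
Qed.

Let v_ge0 (i : 'I_n) : 0 <= v.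
Proof. by rewrite -(X2 i); apply: Rintegral_ge0 => w _; exact: sqr_ge0. Qed.

(** The first-order term of the expansion of [f1] at [rest i] has expectation
[E X_i * E f2(rest i) = 0]. *)
Let derivative_defect i :
  `|\int[P]_w f1 (S w) - \int[P]_w f1 (rest i w)|%R <= K * v / 2.
Proof.
pose r w := f1 (S w) - f1 (rest i w) - X i w ^+ 1 * f2 (rest i w).
have rK w : `|r w| <= K / 2 * X i w ^+ 2.
  have := taylor2 (rest i w) (X i w) df1 df2 f3K.
  by rewrite /r (sumRV_rest i) expr1 (addrC (X i w)) mulrAC.
have i1 := integB (integ_f1 (index_enum 'I_n)) (integ_f1 [seq j <- index_enum 'I_n | j != i]).
have i2 := integ_prod (isT : 1 <= 4)%N mf2 (integ_f2 [seq j <- index_enum 'I_n | j != i]).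
have ir : integ r := integB i1 i2.
have iK : integ (fun w => K / 2 * X i w ^+ 2) := integZ _ (iexp i (isT : 2 <= 4)%N).
have := Rintegral_norm_le ir iK rK.
rewrite RintegralB// RintegralB//; [|exact: integ_f1|exact: integ_f1].
rewrite (exp_prod (X1 i) isT mf2 (integ_f2 _)) mul0r subr0 RintegralZl//; last exact: iexp.
by rewrite X2 mulrAC.
Qed.

Let rem i w := X i w * f (S w) - (X i w ^+ 1 * f (rest i w) +
  X i w ^+ 2 * f1 (rest i w) + 2^-1 * (X i w ^+ 3 * f2 (rest i w))).

Let rem_le i w : `|rem i w| <= K / 6 * X i w ^+ 4.
Proof.
have := taylor3 (rest i w) (X i w) df df1 df2 f3K.
have -> : rem i w = X i w * (f (rest i w + X i w) - f (rest i w) -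
    X i w * f1 (rest i w) - X i w ^+ 2 / 2 * f2 (rest i w)).
  by rewrite /rem (sumRV_rest i) (addrC (X i w)); field.
move=> h; rewrite normrM; apply: (le_trans (ler_wpM2l (normr_ge0 _) h)).
have -> : X i w ^+ 4 = `|X i w| ^+ 4.
  by rewrite -normrX ger0_norm// exprn_even_ge0.
by rewrite le_eqVlt; apply/orP; left; apply/eqP; field.
Qed.

Let integ_main i : integ (fun w => X i w ^+ 1 * f (rest i w) +
  X i w ^+ 2 * f1 (rest i w) + 2^-1 * (X i w ^+ 3 * f2 (rest i w))).
Proof.
apply: (integD (integD _ _) (integZ _ _)).
- by apply: integ_prod => //; exact: integ_f.
- by apply: integ_prod => //; exact: integ_f1.
- by apply: integ_prod => //; exact: integ_f2.
Qed.

Let exp_main i : (\int[P]_w (X i w ^+ 1 * f (rest i w) +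
  X i w ^+ 2 * f1 (rest i w) + 2^-1 * (X i w ^+ 3 * f2 (rest i w))) =
  v * \int[P]_w f1 (rest i w))%R.
Proof.
have i1 : integ (fun w => X i w ^+ 1 * f (rest i w)).
  by apply: integ_prod => //; exact: integ_f.
have i2 : integ (fun w => X i w ^+ 2 * f1 (rest i w)).
  by apply: integ_prod => //; exact: integ_f1.
have i3 : integ (fun w => X i w ^+ 3 * f2 (rest i w)).
  by apply: integ_prod => //; exact: integ_f2.
rewrite RintegralD//; [|exact: integD|exact: integZ].
rewrite RintegralD// RintegralZl//.
rewrite (exp_prod (X1 i) isT mf (integ_f _)) (exp_prod (X2 i) isT mf1 (integ_f1 _)).
rewrite (exp_prod (X3 i) isT mf2 (integ_f2 _)).
by rewrite !mul0r mulr0 add0r addr0.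
Qed.

Let integ_rem i : integ (rem i).
Proof.
apply: (integ_le _ (integZ (K / 6) (iX4 i)) (@rem_le i)).
apply: measurable_funB; last first.
  by have /integrableP[/measurable_EFinP] := integ_main i.
by apply: measurable_funM => //; exact: measurableT_comp.
Qed.

Let integ_summand i : integ (fun w => X i w * f (S w)).
Proof.
have := integD (integ_rem i) (integ_main i).
by apply: eq_integrable => // w _; rewrite /= subrK.
Qed.

Let summand_defect i :
  `|\int[P]_w (X i w * f (S w)) - v * \int[P]_w f1 (S w)|%R <=
    K * (m4 / 6 + v ^+ 2 / 2).
Proof.
have h1 := Rintegral_norm_le (integ_rem i) (integZ (K / 6) (iX4 i)) (@rem_le i).
move: h1; rewrite RintegralB//= exp_main RintegralZl// X4 => h1.
have := ler_wpM2l (v_ge0 i) (derivative_defect i).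
move: h1; set a := Rintegral _ _ _; set b := Rintegral _ _ _.
set c := Rintegral _ _ _ => h1 h2.
have -> : a - v * c = (a - v * b) - v * (c - b) by ring.
apply: (le_trans (ler_normB _ _)); rewrite normrM (ger0_norm (v_ge0 i)); lra.
Qed.

(** Adding the defects of the [n] summands. The exact identity would be
[E (S f(S)) = n v E f1(S)], as for a Gaussian [S]. *)
Lemma stein_identity_defect :
  [/\ integ (fun w => S w * f (S w)), integ (fun w => f1 (S w)) &
  `|\int[P]_w (S w * f (S w)) - n%:R * v * \int[P]_w f1 (S w)|%R <=
    K * n%:R * (m4 / 6 + v ^+ 2 / 2)].
Proof.
have SE w : S w * f (S w) = \sum_i X i w * f (S w).
  by rewrite -mulr_suml /S /sumRV sum_RVE.
have iSf : integ (fun w => \sum_i X i w * f (S w)).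
  by apply: integ_sum => i; exact: integ_summand.
split; [by under eq_fun do rewrite SE|exact: integ_f1|].
under eq_Rintegral do rewrite SE.
rewrite Rintegral_sum//.
have -> : n%:R * v * (\int[P]_w f1 (S w))%R = \sum_(i < n) (v * \int[P]_w f1 (S w))%R.
  by rewrite sumr_const card_ord -mulrA mulr_natl.
rewrite -sumrB; apply: (le_trans (ler_norm_sum _ _ _)).
apply: (@le_trans _ _ (\sum_(i < n) (K * (m4 / 6 + v ^+ 2 / 2)))).
  by apply: ler_sum => i _; exact: summand_defect.
by rewrite sumr_const card_ord -[leLHS]mulr_natl mulrA (mulrC n%:R).
Qed.

End stein_for_sums.

(** * Infinitely divisible variables *)

(** Expectations depend only on the law, which lets the summands live on a
space of their own. *)
Section change_of_space.
Context d (T : measurableType d) (R : realType) (P : probability T R).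
Context d' (T' : measurableType d') (Q : probability T' R).
Variables (W : {RV P >-> R}) (V : {RV Q >-> R}) (g : R -> R).
Hypothesis WV : same_law (distribution P W) (distribution Q V).
Hypothesis mg : measurable_fun setT g.

Lemma integrable_same_law : P.-integrable setT (EFin \o (fun w => g (W w))) ->
  Q.-integrable setT (EFin \o (fun w => g (V w))).
Proof.
move=> /integrableP[_ igW]; apply/integrableP; split.
  by apply/measurable_EFinP; exact: measurableT_comp.
have mag : measurable_fun setT (fun x : R => `|(g x)%:E|%E).
  by apply: measurableT_comp => //; exact/measurable_EFinP.
have := ge0_integral_distribution V mag (fun x => abse_ge0 _).
rewrite /comp => <-.
have := ge0_integral_distribution W mag (fun x => abse_ge0 _).
rewrite /comp => eW; rewrite -eW in igW.
rewrite (eq_measure_integral (distribution P W))// => A mA _; exact: esym (WV mA).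
Qed.

Lemma Rintegral_same_law : P.-integrable setT (EFin \o (fun w => g (W w))) ->
  (\int[P]_w g (W w) = \int[Q]_w g (V w))%R.
Proof.
move=> igW; have igV := integrable_same_law igW.
have mEg : measurable_fun setT (EFin \o g) by exact/measurable_EFinP.
rewrite /Rintegral; congr fine.
have := integral_distribution mEg igW; rewrite /comp => <-.
have := integral_distribution mEg igV; rewrite /comp => <-.
apply: eq_measure_integral => A mA _; exact: WV.
Qed.

End change_of_space.

Section infinitely_divisible_stein.
Context d (T : measurableType d) (R : realType) (P : probability T R).
Variable W : {RV P >-> R}.
Local Notation integ u := (P.-integrable setT (EFin \o u)).
Local Notation mom k := (\int[P]_w (W w ^+ k))%R.
Hypotheses (W_inf_div : infinitely_divisible W)
  (iW4 : integ (fun w => W w ^+ 4)).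
Hypotheses (W1 : mom 1 = 0) (W2 : mom 2 = 1) (W3 : mom 3 = 0).

Lemma le_of_le_addV (a b c : R) : (forall n : nat, a <= b + c / n.+1%:R) -> a <= b.
Proof.
move=> abc; apply/ler_addgt0Pr => e e0.
(* Any n larger than |c| / e makes the error term smaller than e. *)
have := abc (Num.truncn (`|c| / e)) => /le_trans; apply.
rewrite lerD2l ler_pdivrMr// mulrC -ler_pdivrMr//.
apply: (@le_trans _ _ (`|c| / e)).
  by rewrite ler_pM2r ?invr_gt0// ler_norm.
by apply: ltW; exact: truncnS_gt.
Qed.

(** The moments of the summands are obtained by inverting [moments_sumRV],
whose fourth line gives n * E X_i^4 + 3 * (n - 1) / n = E W^4. *)
Lemma iid_decomposition (n : nat) : exists (d' : measure_display)
  (T' : measurableType d') (Q : probability T' R) (X : 'I_n.+1 -> {RV Q >-> R}),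
  [/\ mutually_independent X,
    forall i, Q.-integrable setT (EFin \o (fun w => X i w ^+ 4)),
    same_law (distribution P W) (distribution Q (sumRV X (index_enum 'I_n.+1))),
    forall i, [/\ (\int[Q]_w (X i w ^+ 1) = 0)%R,
      (\int[Q]_w (X i w ^+ 2) = n.+1%:R^-1)%R & (\int[Q]_w (X i w ^+ 3) = 0)%R] &
    forall i, (\int[Q]_w (X i w ^+ 4) = (mom 4 - 3 + 3 / n.+1%:R) / n.+1%:R)%R].
Proof.
have [d' [T' [Q [X [[indX eqX] WX]]]]] := W_inf_div (ltn0Sn n).
exists d', T', Q, X.
pose S := sumRV X (index_enum 'I_n.+1).
have WS : same_law (distribution P W) (distribution Q S).
  move=> A mA; rewrite WX// /distribution /pushforward; congr (Q _).
  by apply/seteqP; split => w; rewrite /preimage /= /S /sumRV sum_RVE.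
have mx k : measurable_fun setT (fun x : R => x ^+ k) by exact: measurable_funX.
have iS4 : Q.-integrable setT (EFin \o (fun w => S w ^+ 4)).
  exact: (integrable_same_law WS (mx 4) iW4).
have iX4 i : Q.-integrable setT (EFin \o (fun w => X i w ^+ 4)).
  have ind : independent (X i) (sumRV X [seq j <- index_enum 'I_n.+1 | j != i]).
    by apply: (independent_sumRV indX); rewrite mem_filter /= eqxx.
  apply: (integrable_indep_summand ind).
  by move: iS4; under eq_fun do rewrite /S (sumRV_rest X i).
have momS k : (k <= 4)%N -> (\int[Q]_w (S w ^+ k) = mom k)%R.
  move=> k4; apply/esym; apply: (Rintegral_same_law WS (mx k)).
  exact: integ_exp.
have momX k i : (k <= 4)%N -> (\int[Q]_w (X i w ^+ k) = \int[Q]_w (X ord0 w ^+ k))%R.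
  move=> k4; apply: (Rintegral_same_law (eqX i ord0) (mx k)); exact: integ_exp.
have size_n : size (index_enum 'I_n.+1) = n.+1.
  by rewrite -sum1_size sum1_card card_ord.
have n0 : n.+1%:R != 0 :> R by rewrite pnatr_eq0.
have X1 i : (\int[Q]_w (X i w ^+ 1) = 0)%R.
  rewrite momX//; have := momS 1%N isT; rewrite W1.
  have -> : (\int[Q]_w (S w ^+ 1) = \sum_i \int[Q]_w (X i w ^+ 1))%R.
    rewrite -Rintegral_sum; last by move=> j; exact: integ_exp.
    by apply: eq_Rintegral => w _; rewrite expr1 /S /sumRV sum_RVE.
  under eq_bigr do rewrite momX//.
  rewrite sumr_const card_ord => /eqP; rewrite mulrn_eq0 /= => /eqP; exact.
have [_ S2 S3 S4] := moments_sumRV indX iX4 X1 (fun i => momX 2 i isT)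
  (fun i => momX 3 i isT) (fun i => momX 4 i isT) (index_enum_uniq _).
move: S2 S3 S4; rewrite !momS// size_n W2 W3 => S2 S3 S4.
have X2 : (\int[Q]_w (X ord0 w ^+ 2) = n.+1%:R^-1)%R.
  by apply: (mulfI n0); rewrite -S2 divff.
have X3 : (\int[Q]_w (X ord0 w ^+ 3) = 0)%R.
  by apply: (mulfI n0); rewrite -S3 mulr0.
split => //; first by move=> i; rewrite X1 !momX.
by move=> i; rewrite momX// S4 X2; field; rewrite ?pnatr_eq0.
Qed.

Lemma fourth_cumulant_ge0 : 0 <= mom 4 - 3.
Proof.
apply: (@le_of_le_addV _ _ 3) => n.
have [d' [T' [Q [X [_ _ _ _ X4]]]]] := iid_decomposition n.
have : 0 <= (\int[Q]_w (X ord0 w ^+ 4))%R.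
  by apply: Rintegral_ge0 => w _; rewrite exprn_even_ge0.
by rewrite X4 pmulr_lge0// invr_gt0.
Qed.

(** With v = 1 / n, the defect of [stein_identity_defect] is
K * n * (m4 / 6 + v^2 / 2) = K / 6 * kappa + K / n. *)
Lemma infinitely_divisible_stein_bound (f f1 f2 f3 : R -> R) (K : R) :
  (forall x : R, is_derive x 1 f (f1 x)) ->
  (forall x : R, is_derive x 1 f1 (f2 x)) ->
  (forall x : R, is_derive x 1 f2 (f3 x)) -> (forall x, `|f3 x| <= K) ->
  [/\ integ (fun w => W w * f (W w)), integ (fun w => f1 (W w)) &
  `|\int[P]_w (W w * f (W w)) - \int[P]_w f1 (W w)|%R <= K / 6 * (mom 4 - 3)].
Proof.
move=> df df1 df2 f3K.
have mf1 : measurable_fun setT f1.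
  by apply: continuous_measurable_fun; exact: (is_derive_continuous df1).
have mxf : measurable_fun setT (fun x : R => x * f x).
  apply: measurable_funM => //.
  by apply: continuous_measurable_fun; exact: (is_derive_continuous df).
have back g (d' : measure_display) (T' : measurableType d') (Q : probability T' R)
    (V : {RV Q >-> R}) : same_law (distribution P W) (distribution Q V) ->
    measurable_fun setT g -> Q.-integrable setT (EFin \o (fun w => g (V w))) ->
    integ (fun w => g (W w)).
  move=> WV mg; apply: (@integrable_same_law _ _ _ _ _ _ _ V W g) => // A mA.
  by apply/esym; exact: WV.
have key n : [/\ integ (fun w => W w * f (W w)), integ (fun w => f1 (W w)) &
  `|\int[P]_w (W w * f (W w)) - \int[P]_w f1 (W w)|%R <=
     K / 6 * (mom 4 - 3) + K / n.+1%:R].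
  have [d' [T' [Q [X [indX iX4 WS X123 X4]]]]] := iid_decomposition n.
  have [X1 X2 X3] : [/\ forall i, (\int[Q]_w (X i w ^+ 1) = 0)%R,
      forall i, (\int[Q]_w (X i w ^+ 2) = n.+1%:R^-1)%R &
      forall i, (\int[Q]_w (X i w ^+ 3) = 0)%R].
    by split => i; have [] := X123 i.
  have [iSf iSf1] := stein_identity_defect indX iX4 X1 X2 X3 X4 df df1 df2 f3K.
  have iWf := back _ _ _ _ _ WS mxf iSf.
  have iWf1 := back _ _ _ _ _ WS mf1 iSf1.
  have n0 : n.+1%:R != 0 :> R by rewrite pnatr_eq0.
  rewrite -(Rintegral_same_law WS mxf iWf) -(Rintegral_same_law WS mf1 iWf1).
  rewrite divff// mul1r => bound; split => //; apply: (le_trans bound).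
  by rewrite le_eqVlt; apply/orP; left; apply/eqP; field.
have [iWf iWf1 _] := key 0%N; split => //.
by apply: (@le_of_le_addV _ _ K) => n; have [] := key n.
Qed.

End infinitely_divisible_stein.

(** * Gaussian expectations *)

Section gaussian_expectation.
Context {R : realType}.
Local Notation lambda := (@lebesgue_measure R).
Local Notation w := (@gauss_weight R).
Local Notation N01 := (@normal_prob R 0 1).
Implicit Types (h : R -> R).

Lemma normal_pdf01E x : normal_pdf 0 1 x = normal_peak 1 * w x :> R.
Proof.
rewrite normal_pdfE ?oner_eq0//; congr (_ * expR _).
by rewrite subr0 expr1n mulNr.
Qed.

(** The Radon-Nikodym derivative of the normal law is its density almost
everywhere, because both have the same integral on every measurable set. *)
Lemma ge0_integral_normal_prob (f : R -> \bar R) : measurable_fun setT f ->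
  (forall x, (0 <= f x)%E) ->
  (\int[N01]_x f x = \int[lambda]_x (f x * (normal_pdf 0 1 x)%:E))%E.
Proof.
move=> mf f0.
have dom := @normal_prob_dominates R 0 1.
rewrite -(@Radon_Nikodym_SigmaFinite.change_of_variables _ _ _ N01 lambda dom
  f setT f0 measurableT mf).
apply: ae_eq_integral => //.
- apply: emeasurable_funM => //; apply: (measurable_int lambda).
  exact: Radon_Nikodym_SigmaFinite.f_integrable.
- apply: emeasurable_funM => //; apply/measurable_EFinP.
  exact: measurable_normal_pdf.
- apply: ae_eqe_mul2l; apply: integral_ae_eq => //.
  + exact: Radon_Nikodym_SigmaFinite.f_integrable.
  + by apply/measurable_EFinP; exact: measurable_normal_pdf.
  + by move=> E _ mE; rewrite -Radon_Nikodym_SigmaFinite.f_integral.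
Qed.

Lemma integral_normal_prob (f : R -> \bar R) : N01.-integrable setT f ->
  (\int[N01]_x f x = \int[lambda]_x (f x * (normal_pdf 0 1 x)%:E))%E.
Proof.
move=> intf; have dom := @normal_prob_dominates R 0 1.
rewrite -(Radon_Nikodym_change_of_variables dom)//.
have mf := measurable_int _ intf.
apply: ae_eq_integral => //.
- by apply: emeasurable_funM.
- apply: emeasurable_funM => //; apply/measurable_EFinP.
  exact: measurable_normal_pdf.
- apply: ae_eqe_mul2l => /=; rewrite Radon_NikodymE//=.
  case: cid => /= k [k1 k2 k3]; apply: integral_ae_eq => //=.
  + by apply/measurable_EFinP; exact: measurable_normal_pdf.
  + by move=> E _ mE; rewrite -k3.
Qed.

Section variable.
Context d (T : measurableType d) (Q : probability T R) (Z : {RV Q >-> R}).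
Hypothesis Z_normal : same_law (distribution Q Z) N01.
Variables (h : R -> R) (a b : R).
Hypotheses (ch : continuous h) (hab : forall x, `|h x| <= a + b * x ^+ 2).

Let mh : measurable_fun setT h. Proof. exact: continuous_measurable_fun. Qed.
Let mEh : measurable_fun setT (EFin \o h). Proof. exact/measurable_EFinP. Qed.

Let integrable_hw : lambda.-integrable setT (EFin \o (fun x => h x * w x)).
Proof. exact: integrable_mul_gauss_weight ch hab. Qed.

Let integrable_N01 : N01.-integrable setT (EFin \o h).
Proof.
apply/integrableP; split => //.
rewrite ge0_integral_normal_prob//; last exact: measurableT_comp.
have /integrableP[_] := integrableZl measurableT (normal_peak 1) integrable_hw.
apply: le_lt_trans; apply: ge0_le_integral => //.
- by move=> x _; rewrite mule_ge0// lee_fin normal_pdf_ge0.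
- apply: emeasurable_funM; first exact: measurableT_comp.
  by apply/measurable_EFinP; exact: measurable_normal_pdf.
- apply: measurableT_comp => //.
  exact: measurable_int (integrableZl measurableT (normal_peak 1) integrable_hw).
- move=> x _; rewrite /= normal_pdf01E lee_fin !normrM mulrCA.
  by rewrite (ger0_norm (normal_peak_ge0 1)) (ger0_norm (ltW (gauss_weight_gt0 x))).
Qed.

(* The same variable, with values in the line carrying the structure on which
   the Lebesgue measure is defined. *)
Let measurable_Z' : @measurable_fun _ _ T (measurableTypeR R) setT Z.
Proof. by move=> _ A mA; rewrite setTI; exact: (measurable_funPTI Z mA). Qed.
Let Z' : {mfun T >-> measurableTypeR R} :=
  @mfun_Sub _ _ T (measurableTypeR R) Z (mem_set measurable_Z').

Lemma integrable_gaussian : Q.-integrable setT (EFin \o (fun t => h (Z t))).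
Proof.
apply/integrableP; split.
  by apply/measurable_EFinP; exact: measurableT_comp.
have mag : measurable_fun setT (fun x : measurableTypeR R => `|(h x)%:E|%E).
  by apply: measurableT_comp.
have := ge0_integral_distribution (Z' : {RV Q >-> measurableTypeR R}) mag (fun x => abse_ge0 _).
rewrite /comp => <-.
rewrite (eq_measure_integral N01) => [|A mA _]; last exact: Z_normal.
by have /integrableP[_] := integrable_N01.
Qed.

(** This is the solvability condition of the Stein equation. *)
Lemma gaussian_centering :
  (\int[lambda]_x ((h x - \int[Q]_t h (Z t)) * w x))%R = 0.
Proof.
have p0 := @normal_peak_gt0 R 1 (oner_neq0 R).
have c1 : (normal_peak 1 * \int[lambda]_x w x)%R = 1.
  rewrite -RintegralZl//; last exact: integrable_gauss_weight.
  rewrite /Rintegral; under eq_integral do rewrite -normal_pdf01E.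
  by rewrite integral_normal_pdf.
have c2 : (\int[Q]_t h (Z t) = normal_peak 1 * \int[lambda]_x (h x * w x))%R.
  rewrite -RintegralZl// /Rintegral; congr fine.
  have := @integral_distribution _ _ _ _ _ Q (Z' : {RV Q >-> measurableTypeR R})
    _ mEh integrable_gaussian; rewrite /comp => <-.
  transitivity (\int[N01]_x (EFin \o h) x)%E.
    by apply: eq_measure_integral => A mA _; exact: Z_normal.
  rewrite integral_normal_prob//; apply: eq_integral => x _.
  by rewrite normal_pdf01E -EFinM mulrCA.
under eq_Rintegral do rewrite mulrBl.
rewrite RintegralB//; last exact: integrableZl integrable_gauss_weight.
rewrite RintegralZl//; last exact: integrable_gauss_weight.
have pn0 : normal_peak 1 != 0 :> R by rewrite gt_eqF.
apply: (mulfI pn0); rewrite mulrBr mulrCA c1 mulr1 -c2; ring.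
Qed.

End variable.
End gaussian_expectation.

(** * Smooth approximations of half-line indicators *)

Section steep_functions.
Context {R : realType}.
Variable a : R.
Implicit Types (x : R) (n : nat).

(** The argument n^2 * (x - a) - n tends to plus infinity for x > a and to
minus infinity for x <= a. The shift by n is what sends the point a itself to 0,
so that the limit is exactly the indicator of an open half-line. *)
Definition slope n : R := n%:R ^+ 2.
Definition steep n x : R := 2^-1 + pi^-1 * atan (slope n * (x - a) - n%:R).

Let steep' n x : R :=
  pi^-1 * slope n * (1 + (slope n * (x - a) - n%:R) ^+ 2)^-1.
Let steep'' n x : R := - (pi^-1 * slope n ^+ 2 * (2 * (slope n * (x - a) - n%:R))
  * (1 + (slope n * (x - a) - n%:R) ^+ 2) ^- 2).

Let is_derive_arg n x :
  is_derive x 1 (fun y => slope n * (y - a) - n%:R) (slope n).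
Proof. by apply: is_derive_eq; rewrite /GRing.scale/=; ring. Qed.

Lemma steep_smooth n : exists u' u'' M,
  [/\ forall x : R, is_derive x 1 (steep n) (u' x),
      forall x : R, is_derive x 1 u' (u'' x) & forall x, `|u'' x| <= M].
Proof.
exists (steep' n), (steep'' n), (pi^-1 * slope n ^+ 2).
have p1 (y : R) : 0 < 1 + y ^+ 2 by rewrite ltr_pwDl// sqr_ge0.
split => x.
- have da := is_derive_arg n x.
  have dA := @is_derive1_comp R (@atan R) (fun y => slope n * (y - a) - n%:R) x _ _
    (is_derive1_atan _) da.
  by apply: is_derive_eq; rewrite /GRing.scale/= /steep'; ring.
- have da := is_derive_arg n x.
  have q0 : 1 + (slope n * (x - a) - n%:R) ^+ 2 != 0 by rewrite gt_eqF.
  have dq : is_derive x 1 (fun y => 1 + (slope n * (y - a) - n%:R) ^+ 2)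
      (2 * (slope n * (x - a) - n%:R) * slope n).
    by apply: is_derive_eq; rewrite /GRing.scale/=; ring.
  have dV := @is_deriveV R (fun y => 1 + (slope n * (y - a) - n%:R) ^+ 2) x _ 1 q0 dq.
  by apply: is_derive_eq; rewrite /GRing.scale/= /steep''; ring.
- set y := slope n * (x - a) - n%:R.
  have s0 : 0 <= pi^-1 * slope n ^+ 2 by rewrite mulr_ge0 ?sqr_ge0// invr_ge0 pi_ge0.
  rewrite /steep'' -/y normrN -mulrA normrM (ger0_norm s0) ler_piMr//.
  have q0 : 0 < (1 + y ^+ 2) ^+ 2 by rewrite exprn_gt0.
  rewrite normrM normfV (gtr0_norm q0).
  rewrite ler_pdivrMr// mul1r.
  rewrite ler_norml; have := sqr_ge0 (y - 1); have := sqr_ge0 (y + 1).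
  have := sqr_ge0 y; rewrite !expr2; nra.
Qed.

Lemma steep_norm_le1 n x : `|steep n x| <= 1.
Proof.
have := @atan_gtNpi2 R (slope n * (x - a) - n%:R).
have := @atan_ltpi2 R (slope n * (x - a) - n%:R).
have := @pi_gt0 R; rewrite /steep; set t := atan _ => p0 t1 t2.
have pn0 : pi != 0 :> R by rewrite gt_eqF.
have -> : 2^-1 + pi^-1 * t = (pi / 2 + t) / pi.
  by move: pn0; generalize (pi : R) => p pn0; field.
rewrite normrM normfV (gtr0_norm p0) ler_pdivrMr// mul1r ger0_norm; lra.
Qed.

Lemma cvg_steep x : steep n x @[n --> \oo] --> (\1_(`]a, +oo[%classic : set R) x : R).
Proof.
have cn : atan (n%:R : R) @[n --> \oo] --> pi / 2.
  exact: cvg_comp (@cvgr_idn R) (@cvgy_atan R).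
have pn0 : pi != 0 :> R by rewrite gt_eqF ?pi_gt0.
rewrite indicE; have [xa|xa] := ltP a x.
- have -> : x \in (`]a, +oo[%classic : set R) by rewrite inE/= in_itv/= xa.
  have lim1 : 1%:R = 2^-1 + pi^-1 * (pi / 2) :> R.
    by move: pn0; generalize (pi : R) => p pn0; field.
  rewrite lim1; apply: cvgD; first exact: cvg_cst.
  apply: cvgM; first exact: cvg_cst.
  apply: squeeze_cvgr cn (cvg_cst _).
  near=> n; rewrite [X in _ && X]ltW ?atan_ltpi2// andbT le_atan//.
  have n2 : 2 / (x - a) <= n%:R by near: n; exact: nbhs_infty_ger.
  rewrite ler_pdivrMr ?subr_gt0// in n2.
  rewrite lerBrDr /slope expr2 -mulrA -[X in X <= _](mulr1 (n%:R + n%:R)).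
  have n0 : 0 <= n%:R :> R by [].
  nra.
- have -> : (x \in (`]a, +oo[%classic : set R)) = false.
    by apply/negbTE; rewrite notin_setE/= in_itv/= andbT; apply/negP; rewrite -leNgt.
  have lim0 : 0%:R = 2^-1 + pi^-1 * (- (pi / 2)) :> R.
    by move: pn0; generalize (pi : R) => p pn0; field.
  rewrite lim0; apply: cvgD; first exact: cvg_cst.
  apply: cvgM; first exact: cvg_cst.
  apply: (@squeeze_cvgr _ _ _ _ (cst (- (pi / 2))) (fun n => - atan (n%:R))).
  + near=> n; rewrite [X in X && _]ltW ?atan_gtNpi2//= -atanN le_atan//.
    have s0 : 0 <= slope n by rewrite sqr_ge0.
    nra.
  + exact: cvg_cst.
  + exact: cvgN.
Unshelve. all: by end_near. Qed.

End steep_functions.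

(** * Laws determined by smooth test functions, and the bound *)

Section smooth_test_functions.
Context {R : realType}.

Lemma cvg_steep_probability d (T : measurableType d) (P : probability T R)
    (W : {RV P >-> R}) (a : R) :
  (\int[P]_w steep a n (W w))%R @[n --> \oo] --> fine (P (W @^-1` `]a, +oo[)).
Proof.
have mW : measurable (W @^-1` `]a, +oo[).
  exact: (measurable_funPTI W (measurable_itv _)).
have msteep n : measurable_fun setT (steep a n).
  have [u' [u'' [M [du _ _]]]] := steep_smooth a n.
  by apply: continuous_measurable_fun; exact: (is_derive_continuous du).
have [] := @dominated_convergence _ _ _ P setT measurableT
  (fun n w => (steep a n (W w))%:E) (fun w => (\1_(W @^-1` `]a, +oo[) w)%:E) (cst 1%E).
- by move=> n; apply/measurable_EFinP; exact: measurableT_comp.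
- by apply/measurable_EFinP; exact: measurable_indic.
- by apply: aeW => w _; apply: cvg_EFin; [exact: nearW|exact: cvg_steep].
- exact: finite_measure_integrable_cst.
- by apply: aeW => w n _; rewrite lee_fin steep_norm_le1.
move=> _ _; rewrite integral_indic// setIT => cvgP.
by apply: fine_cvg; rewrite fineK// fin_num_measure.
Qed.

(** Dominated convergence along [steep] identifies the two laws on open
half-lines, which generate the Borel sets. *)
Lemma same_law_of_smooth d (T : measurableType d) (P : probability T R)
    (W : {RV P >-> R}) d' (T' : measurableType d') (Q : probability T' R)
    (Z : {RV Q >-> R}) :
  (forall (u u' u'' : R -> R) (M : R), (forall x : R, is_derive x 1 u (u' x)) ->
    (forall x : R, is_derive x 1 u' (u'' x)) -> (forall x, `|u'' x| <= M) ->
    (\int[P]_w u (W w) = \int[Q]_w u (Z w))%R) ->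
  same_law (distribution P W) (distribution Q Z).
Proof.
move=> WZ A mA.
have GE : (@measurable _ (measurableTypeR R)) = <<s @RGenOInfty.G R >>.
  exact: RGenOInfty.measurableE.
apply: (measure_unique (@RGenOInfty.G R) (fun k => `]- k%:R, +oo[%classic)) mA.
- exact: GE.
- move=> _ _ [x ->] [y ->]; exists (Num.max x y).
  apply/seteqP; split => z; rewrite /= !in_itv/= !andbT gt_max.
    by move=> [-> ->].
  by move=> /andP[].
- by move=> k; exists (- k%:R).
- rewrite -subTset => x _; exists (Num.truncn `|x|).+1 => //=.
  rewrite in_itv/= andbT ltrNl (le_lt_trans (ler_norm _))// normrN.
  exact: truncnS_gt.
- move=> _ [a ->].
  have fP : fine (P (W @^-1` `]a, +oo[)) = fine (Q (Z @^-1` `]a, +oo[)).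
    have cP := @cvg_steep_probability _ _ P W a.
    have cQ := @cvg_steep_probability _ _ Q Z a.
    apply: (cvg_unique _ cP); rewrite //.
    apply: cvg_trans cQ; apply: near_eq_cvg; near=> n.
    by have [u' [u'' [M [du du' uM]]]] := steep_smooth a n; rewrite (WZ _ _ _ _ du du' uM).
  have mP : P (W @^-1` `]a, +oo[) \is a fin_num.
    by rewrite fin_num_measure//; exact: (measurable_funPTI W (measurable_itv _)).
  have mQ : Q (Z @^-1` `]a, +oo[) \is a fin_num.
    by rewrite fin_num_measure//; exact: (measurable_funPTI Z (measurable_itv _)).
  have PQ : P (W @^-1` `]a, +oo[) = Q (Z @^-1` `]a, +oo[).
    by rewrite -(fineK mP) -(fineK mQ) fP.
  exact: PQ.
- move=> k; rewrite -ge0_fin_numE// fin_num_measure//.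
Unshelve. all: by end_near. Qed.

End smooth_test_functions.

Section main_bound.
Context d (T : measurableType d) (R : realType) (P : probability T R).
Context d' (T' : measurableType d') (Q : probability T' R).
Variables (W : {RV P >-> R}) (Z : {RV Q >-> R}).
Hypotheses (W_inf_div : infinitely_divisible W)
  (iW4 : P.-integrable setT (EFin \o (fun w => W w ^+ 4)))
  (W1 : (\int[P]_w (W w ^+ 1))%R = 0) (W2 : (\int[P]_w (W w ^+ 2))%R = 1)
  (W3 : (\int[P]_w (W w ^+ 3))%R = 0)
  (Z_normal : same_law (distribution Q Z) (normal_prob 0 1)).

(** [stein_solution] gives the constant K = 2 * M in
[infinitely_divisible_stein_bound]. *)
Lemma fourth_moment_bound (h h1 h2 : R -> R) (M : R) :
  (forall x : R, is_derive x 1 h (h1 x)) ->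
  (forall x : R, is_derive x 1 h1 (h2 x)) -> (forall x, `|h2 x| <= M) ->
  [/\ P.-integrable setT (EFin \o (fun w => h (W w))),
      Q.-integrable setT (EFin \o (fun w => h (Z w))) &
      `|\int[P]_w h (W w) - \int[Q]_w h (Z w)|%R <=
        3^-1 * M * ((\int[P]_w (W w ^+ 4))%R - 3)].
Proof.
move=> dh dh1 h2M.
have ch := is_derive_continuous dh.
have [a [b hab]] := quadratic_bound dh dh1 h2M.
have iZ := integrable_gaussian Z_normal ch hab.
have iW : P.-integrable setT (EFin \o (fun w => h (W w))).
  apply: (integ_poly_growth _ _ (poly_growth_quadratic hab) iW4) => //.
  exact: continuous_measurable_fun.
split => //.
have [f [f1 [f2 [f3 [df df1 df2 stein f3M]]]]] :=
  stein_solution dh dh1 h2M (gaussian_centering Z_normal ch hab).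
have [iWf iWf1 bound] :=
  infinitely_divisible_stein_bound W_inf_div iW4 W1 W2 W3 df df1 df2 f3M.
set c := (\int[Q]_w _)%R in stein *.
have -> : (\int[P]_w h (W w))%R - c =
    (\int[P]_w f1 (W w))%R - (\int[P]_w (W w * f (W w)))%R.
  rewrite -RintegralB//.
  under [in RHS]eq_Rintegral do rewrite stein.
  rewrite RintegralB//; last exact: integ_cst.
  rewrite Rintegral_cst//; congr (_ - _).
  by rewrite (_ : fine _ = 1) ?mulr1//; exact: (congr1 fine (probability_setT P)).
rewrite distrC; apply: (le_trans bound); rewrite le_eqVlt; apply/orP; left.
by apply/eqP; field.
Qed.

End main_bound.

Theorem theorem10 (R : realType)
    (d : measure_display) (T : measurableType d) (P : probability T R)
    (W : {RV P >-> R})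
    (d' : measure_display) (T' : measurableType d') (Q : probability T' R)
    (Z : {RV Q >-> R}) (h : R -> R)
    (W_inf_div : infinitely_divisible W)
    (EW1 : ('E_P[W] = 0)%E)
    (EW2 : ('E_P[fun w => (W w ^+ 2)%R] = 1)%E)
    (EW3 : ('E_P[fun w => (W w ^+ 3)%R] = 0)%E)
    (EW4 : ('E_P[fun w => (W w ^+ 4)%R] < +oo)%E)
    (Z_normal : same_law (distribution Q Z) (normal_prob 0 1))
    (h_derivable : forall x : R, derivable h x 1)
    (h'_derivable : forall x : R, derivable (h^`())%classic x 1)
    (h'_ac : absolutely_continuous (h^`())%classic) :
  ((supnorm (h^`(2))%classic < +oo)%E ->
     P.-integrable setT (EFin \o (h \o W)) /\
     Q.-integrable setT (EFin \o (h \o Z))) /\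
  (P.-integrable setT (EFin \o (h \o W)) ->
   Q.-integrable setT (EFin \o (h \o Z)) ->
   (`| 'E_P[h \o W] - 'E_Q[h \o Z] | <=
      (3^-1)%R%:E * supnorm (h^`(2))%classic * ('E_P[fun w => (W w ^+ 4)%R] - 3%:E))%E).
Proof.
have pow4_ge0 w : 0 <= W w ^+ 4 by rewrite exprn_even_ge0.
have iW4 : P.-integrable setT (EFin \o (fun w => W w ^+ 4)).
  apply/integrableP; split.
    by apply/measurable_EFinP; exact: measurable_funX.
  rewrite unlock in EW4; apply: le_lt_trans EW4.
  by under eq_integral do rewrite /= ger0_norm//.
have W1 : (\int[P]_w (W w ^+ 1))%R = 0.
  by move: EW1; rewrite unlock /Rintegral => ->.
have W2 : (\int[P]_w (W w ^+ 2))%R = 1.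
  by move: EW2; rewrite unlock /Rintegral => ->.
have W3 : (\int[P]_w (W w ^+ 3))%R = 0.
  by move: EW3; rewrite unlock /Rintegral => ->.
have EW4E : ('E_P[fun w => (W w ^+ 4)%R] = (\int[P]_w (W w ^+ 4))%R%:E)%E.
  by rewrite unlock /Rintegral fineK//; exact: integrable_fin_num.
have dh (x : R) : is_derive x 1 h (h^`()%classic x).
  by apply: (DeriveDef (h_derivable x)); rewrite derive1E.
have dh1 (x : R) : is_derive x 1 (h^`()%classic) (h^`(2)%classic x).
  by apply: (DeriveDef (h'_derivable x)); rewrite /= derive1E.
have norm_le x : (`|h^`(2)%classic x|%:E <= supnorm h^`(2)%classic)%E.
  by apply: ereal_sup_ubound; exists x.
have bound := fourth_moment_bound W_inf_div iW4 W1 W2 W3 Z_normal.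
have fin_case : (supnorm h^`(2)%classic < +oo)%E ->
    exists2 M, supnorm h^`(2)%classic = M%:E & forall x, `|h^`(2)%classic x| <= M.
  case: (supnorm _) norm_le => [M|//|/(_ 0)//] norm_le _.
  by exists M => // x; rewrite -lee_fin.
split=> [/fin_case[M _ hM]|iW iZ].
  by have [] := bound _ _ _ _ dh dh1 hM.
rewrite EW4E.
have EW : ('E_P[h \o W] = (\int[P]_w h (W w))%R%:E)%E.
  by rewrite unlock /Rintegral fineK//; exact: (integrable_fin_num measurableT iW).
have EZ : ('E_Q[h \o Z] = (\int[Q]_w h (Z w))%R%:E)%E.
  by rewrite unlock /Rintegral fineK//; exact: (integrable_fin_num measurableT iZ).
rewrite EW EZ.
have := leey (supnorm h^`(2)%classic); rewrite le_eqVlt => /orP[/eqP ->|].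
- have k0 := fourth_cumulant_ge0 W_inf_div iW4 W1 W2 W3.
  rewrite gt0_muley ?lte_fin ?invr_gt0// -[X in (_ <= _ * X)%E]EFinB.
  move: k0; rewrite le_eqVlt => /orP[/eqP k0|k0]; last first.
    by rewrite gt0_mulye ?lte_fin// leey.
  (* The fourth cumulant vanishes: the product of 0 and the infinite norm is 0. *)
  rewrite -k0 mule0.
  have law : same_law (distribution P W) (distribution Q Z).
    apply: same_law_of_smooth => u u1 u2 M du du1 uM.
    have [_ _] := bound _ _ _ _ du du1 uM; rewrite -k0 mulr0.
    by rewrite normr_le0 subr_eq0 => /eqP.
  have mh : measurable_fun setT h.
    by apply: continuous_measurable_fun; exact: (is_derive_continuous dh).
  by rewrite (Rintegral_same_law law mh iW) -EFinB subrr abse0.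
- move=> /fin_case[M -> hM].
  by have [_ _] := bound _ _ _ _ dh dh1 hM; rewrite -!EFinB -!EFinM lee_fin.
Qed.
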